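(* (i) If $\mathcal{L}$ is a nilpotent finite-dimensional complex Lie algebra, then $r_{P_{\mathfrak{S}^{\max}}}^{\circ}(\mathcal{L})=r_{P_{\mathfrak{J}^{\max}}}^{\circ}(\mathcal{L})=i_{s}(\mathcal{L})$. (ii) If $\mathcal{L}$ is a finite-dimensional complex Lie algebra, then $$i_{s}(\mathcal{N}_{\mathcal{L}})\leq r_{P_{\mathfrak{S}^{\max}}}^{\circ}(\mathcal{L})\leq r_{P_{\mathfrak{J}^{\max}}}^{\circ}(\mathcal{L})=i_{s}(\mathcal{K}_{\mathcal{L}})+1\leq i_{s}(\mathcal{N}_{\mathcal{L}})+1,$$ so that $1\leq r_{P_{\mathfrak{S}^{\max}}}^{\circ}(\mathcal{L})\leq r_{P_{\mathfrak{J}^{\max}}}^{\circ}(\mathcal{L})\leq r_{P_{\mathfrak{S}^{\max}}}^{\circ}(\mathcal{L})+1$.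
   Context: For a finite-dimensional complex Lie algebra $\mathcal{L}$: $P_{\mathfrak{S}^{\max}}(\mathcal{L})$ (the Frattini ideal) is the intersection of all maximal proper Lie subalgebras of $\mathcal{L}$, and $P_{\mathfrak{J}^{\max}}(\mathcal{L})$ (the Jacobson ideal) is the intersection of all maximal proper Lie ideals of $\mathcal{L}$ (each being $\mathcal{L}$ if the family is empty); both are Lie ideals. For $R$ either of these, put $R^{0}(\mathcal{L})=\mathcal{L}$, $R^{n+1}(\mathcal{L})=R(R^{n}(\mathcal{L}))$. Then $r_R^{\circ}(\mathcal{L})$ is the smallest $n$ with $R^{n+1}(\mathcal{L})=R^{n}(\mathcal{L})$, equivalently the least $n$ with $R^{n}(\mathcal{L})=\{0\}$; these numbers are called the Frattini index (for $R=P_{\mathfrak{S}^{\max}}$) and the Jacobson index (for $R=P_{\mathfrak{J}^{\max}}$) of $\mathcal{L}$. $\mathcal{N}_{\mathcal{L}}$ is the nil-radical (maximal nilpotent ideal) of $\mathcal{L}$, $\mathrm{rad}(\mathcal{L})$ is the maximal solvable ideal, and $\mathcal{K}_{\mathcal{L}}=[\mathcal{L},\mathrm{rad}(\mathcal{L})]$. For a solvable Lie algebra $\mathcal{M}$, with $\mathcal{M}_{[0]}=\mathcal{M}$ and $\mathcal{M}_{[n+1]}=[\mathcal{M}_{[n]},\mathcal{M}_{[n]}]$, the solvability index $i_{s}(\mathcal{M})$ is the least $n$ with $\mathcal{M}_{[n]}=\{0\}$.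
   Formalization: Part (ii) is stated for non-zero L: for L = {0} both indices are 0, while i_s(K_L)+1 = 1 and the lower bound is 1, so the claim fails there. *)

(* Defs.v *)
From HB Require Import structures.
From mathcomp Require Import all_boot all_order all_algebra.
From mathcomp Require Import boolp.

Set Implicit Arguments.
Unset Strict Implicit.
Unset Printing Implicit Defensive.

Import GRing.Theory.
Local Open Scope ring_scope.

HB.mixin Record Vector_isLieAlgebra (K : fieldType) L of Vector K L := {
  lie : L -> L -> L;
  lie_linearl : forall y, linear (lie^~ y);
  lie_linearr : forall x, linear (lie x);
  liexx : forall x, lie x x = 0;
  lie_jacobi : forall x y z,
    lie x (lie y z) + lie y (lie z x) + lie z (lie x y) = 0
}.

#[short(type="lieAlgType")]
HB.structure Definition LieAlgebra (K : fieldType) :=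
  { L of Vector_isLieAlgebra K L & Vector K L }.

Section LieTheory.
Variables (K : fieldType) (L : lieAlgType K).
Implicit Types (U V W I J M N A B : {vspace L}) (x y z : L).

HB.instance Definition _ x :=
  GRing.isLinear.Build K L L *:%R (lie x) (@lie_linearr K L x).

Definition lier y x : L := lie x y.
HB.instance Definition _ y :=
  GRing.isLinear.Build K L L *:%R (lier y) (@lie_linearl K L y).

Lemma lieDr x y z : lie x (y + z) = lie x y + lie x z.
Proof. exact: linearD. Qed.

Lemma lieDl x y z : lie (x + y) z = lie x z + lie y z.
Proof. exact: (linearD (lier z)). Qed.

Lemma lieC x y : lie x y = - lie y x.
Proof.
apply/eqP; rewrite -addr_eq0; apply/eqP.
by have := liexx (x + y); rewrite lieDl !lieDr !liexx add0r addr0.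
Qed.

(* [U, V]: the linear span of all brackets, see lievP *)
Definition liev U V : {vspace L} := <<allpairs lie (vbasis U) (vbasis V)>>%VS.

Lemma memv_lie U V : {in U & V, forall u v, lie u v \in liev U V}.
Proof.
move=> u v /coord_vbasis -> /coord_vbasis ->.
rewrite (linear_sum (lie _)) memv_suml //= => j _.
rewrite (linearZ_LR (lie _)) memvZ //= -/(lier (vbasis V)`_j _).
rewrite (linear_sum (lier _)) memv_suml //= => i _.
rewrite (linearZ_LR (lier _)) memvZ //= memv_span // /lier.
by apply/allpairsP; exists ((vbasis U)`_i, (vbasis V)`_j); rewrite !memt_nth.
Qed.

Lemma lievP {U V W} :
  reflect {in U & V, forall u v, lie u v \in W} (liev U V <= W)%VS.
Proof.
apply: (iffP idP) => [sUVW u v Uu Vv | sUVW].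
  by rewrite (subvP sUVW) ?memv_lie.
apply/span_subvP=> _ /allpairsP[[u v] /= [Uu Vv ->]].
by rewrite sUVW ?vbasis_mem.
Qed.

Lemma lievS U1 U2 V1 V2 :
  (U1 <= U2)%VS -> (V1 <= V2)%VS -> (liev U1 V1 <= liev U2 V2)%VS.
Proof.
move=> /subvP sU /subvP sV; apply/lievP => u v /sU Uu /sV Vv.
exact: memv_lie.
Qed.

Lemma liev_sym U V : liev U V = liev V U.
Proof.
wlog suff: U V / (liev U V <= liev V U)%VS.
  by move=> h; apply: subv_anti; rewrite !h.
by apply/lievP => u v Uu Vv; rewrite lieC memvN memv_lie.
Qed.

Lemma lievDr U V W : (liev U (V + W) <= liev U V + liev U W)%VS.
Proof.
apply/lievP => u _ Uu /memv_addP[v Vv [w Ww ->]].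
by rewrite lieDr memv_add ?memv_lie.
Qed.

Lemma lievDl U V W : (liev (U + V) W <= liev U W + liev V W)%VS.
Proof. by rewrite !(liev_sym _ W) lievDr. Qed.

Lemma liev0 U : liev U 0 = 0%VS.
Proof.
apply/eqP; rewrite -subv0; apply/lievP => u v _; rewrite memv0 => /eqP ->.
by rewrite linear0 mem0v.
Qed.

Definition lie_subalg U := (liev U U <= U)%VS.

(* Subalgebras of L are Lie algebras on their own; the notions below are
   relative to such a subalgebra U, and L itself is {:L}. *)
Definition lie_ideal U I := (I <= U)%VS && (liev U I <= I)%VS.

Definition maximal_subalg U M : Prop :=
  [/\ lie_subalg M, (M <= U)%VS, M != U &
      forall V, lie_subalg V -> (M <= V)%VS -> (V <= U)%VS -> V = M \/ V = U].

Definition maximal_ideal U M : Prop :=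
  [/\ lie_ideal U M, M != U &
      forall V, lie_ideal U V -> (M <= V)%VS -> V = M \/ V = U].

Lemma vbigcap_ex U (P : {vspace L} -> Prop) :
  exists W : {vspace L},
    forall x, x \in W <-> x \in U /\ (forall V, P V -> x \in V).
Proof.
have [n] := ubnP (\dim U); elim: n U => // n IHn U; rewrite ltnS => leUn.
have [[V PV nUV]|allP] := pselect (exists2 V, P V & ~~ (U <= V)%VS).
  have ltUV : (\dim (U :&: V) < n)%N.
    apply: leq_trans leUn; rewrite ltn_neqAle dimvS ?capvSl // andbT.
    apply: contra nUV => /eqP eqd.
    have /eqP <- : (U :&: V == U)%VS by rewrite eqEdim capvSl eqd leqnn.
    exact: capvSr.
  have [W WP] := IHn _ ltUV; exists W => x; rewrite WP memv_cap.
  split=> [[/andP[Ux Vx] h]|[Ux h]]; first by split.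
  by split=> //; rewrite Ux h.
exists U => x; split=> [Ux|[]//]; split=> // V PV.
by apply: contrapT => nVx; apply: allP; exists V => //; apply/negP=> /subvP/(_ _ Ux).
Qed.

(* The intersection of U with all the subspaces satisfying P. *)
Definition vbigcap U (P : {vspace L} -> Prop) : {vspace L} :=
  projT1 (cid (vbigcap_ex U P)).

Lemma memv_bigcap U (P : {vspace L} -> Prop) x :
  x \in vbigcap U P <-> x \in U /\ (forall V, P V -> x \in V).
Proof. exact: (projT2 (cid (vbigcap_ex U P))). Qed.

Lemma vbigcap_sub U (P : {vspace L} -> Prop) : (vbigcap U P <= U)%VS.
Proof. by apply/subvP => x /memv_bigcap[]. Qed.

Definition frattini U := vbigcap U (maximal_subalg U).
Definition jacobson U := vbigcap U (maximal_ideal U).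

Lemma frattini_sub U : (frattini U <= U)%VS.
Proof. exact: vbigcap_sub. Qed.

Lemma jacobson_sub U : (jacobson U <= U)%VS.
Proof. exact: vbigcap_sub. Qed.

Lemma iter_stable (f : {vspace L} -> {vspace L}) :
  (forall U, (f U <= U)%VS) -> forall U, exists n, iter n.+1 f U == iter n f U.
Proof.
move=> fsub U; have [n] := ubnP (\dim U); elim: n U => // n IHn U.
rewrite ltnS => leUn; have [fU|nfU] := eqVneq (f U) U.
  by exists 0%N; rewrite /= fU.
have [|m hm] := IHn (f U).
  apply: leq_trans leUn; rewrite ltn_neqAle dimvS ?fsub // andbT.
  by apply: contra nfU => /eqP eqd; rewrite eqEdim fsub eqd leqnn.
by exists m.+1; rewrite !iterSr -iterSr.
Qed.

(* The least n at which the iterates U, f U, f (f U), ... become stationary. *)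
Definition frattini_index U : nat := ex_minn (iter_stable frattini_sub U).
Definition jacobson_index U : nat := ex_minn (iter_stable jacobson_sub U).

Definition derived n U := iter n (fun V => liev V V) U.
Definition lower_central n U := iter n (liev U) U.

Definition solvable U := exists n, derived n U == 0%VS.
Definition nilpotent U := exists n, lower_central n U == 0%VS.

Definition solvability_index U (solU : solvable U) : nat := ex_minn solU.

Lemma derivedS n U V : (U <= V)%VS -> (derived n U <= derived n V)%VS.
Proof. by move=> sUV; elim: n => //= n IHn; apply: lievS. Qed.

Lemma solvableS U V : (U <= V)%VS -> solvable V -> solvable U.
Proof.
move=> sUV [n /eqP Vn]; exists n.
by rewrite -subv0 -Vn derivedS.
Qed.

Lemma lower_central_sub n U : lie_subalg U -> (lower_central n U <= U)%VS.
Proof.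
move=> sU; elim: n => //= n IHn.
exact: subv_trans (lievS (subvv U) IHn) sU.
Qed.

Lemma lie_ideal_subalg U I : lie_ideal U I -> lie_subalg I.
Proof. by case/andP=> sIU; apply: subv_trans; apply: lievS. Qed.

Lemma nilpotent_solvable U : lie_subalg U -> nilpotent U -> solvable U.
Proof.
move=> sU [n /eqP Un]; exists n; rewrite -subv0 -Un.
suff: (derived n U <= lower_central n U)%VS by [].
elim: n {Un} => //= n IHn; apply: lievS => //.
exact: subv_trans IHn (lower_central_sub _ sU).
Qed.

Lemma lie_subalgf : lie_subalg fullv.
Proof. exact: subvf. Qed.

Lemma lie_ideal0 U : lie_ideal U 0%VS.
Proof. by rewrite /lie_ideal sub0v liev0 subvv. Qed.

Lemma nilpotent0 : nilpotent 0%VS.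
Proof. by exists 0%N. Qed.

Lemma solvable0 : solvable 0%VS.
Proof. by exists 0%N. Qed.

Lemma maximal_ex (P : {vspace L} -> Prop) :
  P 0%VS -> exists2 M, P M & forall V, P V -> (M <= V)%VS -> V = M.
Proof.
suff H n U : (\dim {:L} - \dim U < n)%N -> P U ->
    exists2 M, P M & forall V, P V -> (M <= V)%VS -> V = M.
  exact: (H _.+1 _ (ltnSn _)).
elim: n U => // n IHn U ltn PU.
have [[V [PV sUV nVU]]|allU] :=
  pselect (exists V, [/\ P V, (U <= V)%VS & V != U]); last first.
  exists U => // V PV sUV; apply/eqP/negPn/negP => nVU.
  by apply: allU; exists V.
apply: IHn PV; have ltUV : (\dim U < \dim V)%N.
  rewrite ltn_neqAle dimvS // andbT; apply: contra nVU => /eqP eqd.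
  by rewrite eq_sym eqEdim sUV eqd leqnn.
have := dimvS (subvf V); move: ltn ltUV; rewrite ltnS => ltn ltUV leV.
by apply: leq_trans ltn; rewrite ltn_sub2l // (leq_trans ltUV).
Qed.

Lemma nilradical_ex : exists2 N, lie_ideal fullv N /\ nilpotent N &
  forall I, lie_ideal fullv I /\ nilpotent I -> (N <= I)%VS -> I = N.
Proof.
by apply: (@maximal_ex (fun I => lie_ideal fullv I /\ nilpotent I));
  split; [apply: lie_ideal0 | apply: nilpotent0].
Qed.

Lemma radical_ex : exists2 N, lie_ideal fullv N /\ solvable N &
  forall I, lie_ideal fullv I /\ solvable I -> (N <= I)%VS -> I = N.
Proof.
by apply: (@maximal_ex (fun I => lie_ideal fullv I /\ solvable I));
  split; [apply: lie_ideal0 | apply: solvable0].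
Qed.

(* A chosen maximal nilpotent ideal; it contains every nilpotent ideal
   (nilradical_max), hence the choice is unique. *)
Definition nilradical : {vspace L} := projT1 (cid2 nilradical_ex).

(* Likewise for the maximal solvable ideal (radical_max). *)
Definition radical : {vspace L} := projT1 (cid2 radical_ex).

Lemma nilradical_ideal : lie_ideal fullv nilradical.
Proof. by rewrite /nilradical; case: cid2 => N []. Qed.

Lemma nilradical_nilpotent : nilpotent nilradical.
Proof. by rewrite /nilradical; case: cid2 => N []. Qed.

Lemma radical_ideal : lie_ideal fullv radical.
Proof. by rewrite /radical; case: cid2 => N []. Qed.

Lemma radical_solvable : solvable radical.
Proof. by rewrite /radical; case: cid2 => N []. Qed.

Lemma nilradical_solvable : solvable nilradical.
Proof.
apply: nilpotent_solvable nilradical_nilpotent.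
exact: lie_ideal_subalg nilradical_ideal.
Qed.

(* K_L = [L, rad L] *)
Definition lie_rad : {vspace L} := liev fullv radical.

Lemma lie_rad_solvable : solvable lie_rad.
Proof.
apply: solvableS radical_solvable.
by case/andP: radical_ideal.
Qed.

Lemma lie_idealD I J :
  lie_ideal fullv I -> lie_ideal fullv J -> lie_ideal fullv (I + J)%VS.
Proof.
case/andP=> _ hI /andP[_ hJ]; rewrite /lie_ideal subvf /=.
exact: subv_trans (lievDr _ _ _) (addvS hI hJ).
Qed.

Lemma derived_addv n I J : lie_ideal fullv I ->
  (derived n (I + J) <= I + derived n J)%VS.
Proof.
case/andP=> _ hI; elim: n => //= n IHn.
apply: subv_trans (lievS IHn IHn) _; apply: subv_trans (lievDr _ _ _) _.
rewrite subv_add; apply/andP; split.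
  by apply: subv_trans (addvSl _ _); apply: subv_trans hI; apply/lievS/subvv/subvf.
apply: subv_trans (lievDl _ _ _) _; apply: addvS => //.
by rewrite liev_sym; apply: subv_trans hI; apply/lievS/subvv/subvf.
Qed.

Lemma radical_max I : lie_ideal fullv I -> solvable I -> (I <= radical)%VS.
Proof.
rewrite /radical; case: cid2 => M /= [idM [m /eqP solM]] maxM idI [n /eqP solI].
suff solMI : solvable (M + I)%VS.
  by rewrite -(maxM (M + I)%VS) ?addvSl ?addvSr //; split; first exact: lie_idealD.
exists (m + n)%N; rewrite -subv0 -solM /derived iterD.
by apply/derivedS/(subv_trans (derived_addv n I idM)); rewrite solI addv0.
Qed.

(* [L, [U, V]] <= [[L, U], V] + [U, [L, V]] *)
Lemma liev_leibniz A U V :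
  (liev A (liev U V) <= liev (liev A U) V + liev U (liev A V))%VS.
Proof.
set W := (X in (_ <= X)%VS); apply/lievP => a w Aa.
suff /subvP/(_ w) : (liev U V <= linfun (lie a) @^-1: W)%VS.
  by move=> h /h; rewrite -memv_preim lfunE.
apply/lievP => u v Uu Vv; rewrite -memv_preim lfunE /=.
have -> : lie a (lie u v) = lie (lie a u) v + lie u (lie a v).
  have /eqP := lie_jacobi a u v; rewrite -addrA addr_eq0 => /eqP ->.
  by rewrite (lieC v a) linearN (lieC v) opprD !opprK addrC.
by rewrite memv_add // !memv_lie.
Qed.

(* The lower central series of an ideal, shifted and started at L. *)
Let lcs I n := if n is m.+1 then lower_central m I else fullv.

Let lcs_lie I n : lie_ideal fullv I -> (liev I (lcs I n) <= lcs I n.+1)%VS.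
Proof. by case: n => //= /andP[_]; rewrite liev_sym. Qed.

Let lcs_ideal I n : lie_ideal fullv I -> (liev fullv (lcs I n) <= lcs I n)%VS.
Proof.
case: n => [_|n]; first exact: subvf.
move=> /andP[_ hI]; elim: n => //= n IHn.
apply: subv_trans (liev_leibniz _ _ _) _; rewrite subv_add.
by rewrite !lievS.
Qed.

Let lcs_anti I m n : lie_ideal fullv I -> (m <= n)%N -> (lcs I n <= lcs I m)%VS.
Proof.
move=> hI; elim: n => [|n IHn]; first by rewrite leqn0 => /eqP ->.
rewrite leq_eqVlt => /orP[/eqP -> //|/IHn]; apply: subv_trans.
case: n {IHn} => [|n]; first exact: subvf.
by apply: subv_trans (lcs_ideal n.+1 hI); apply/lievS/subvv/subvf.
Qed.

Let lcs_addv I J n : lie_ideal fullv I -> lie_ideal fullv J ->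
  (lower_central n (I + J) <= \sum_(a < n.+2) (lcs I a :&: lcs J (n.+1 - a)))%VS.
Proof.
move=> hI hJ; elim: n => [|n IHn].
  by rewrite !big_ord_recl big_ord0 /= capfv capvf addv0 addvC.
have step m a b : (a + b = m.+1)%N ->
    (lcs I a :&: lcs J b <= \sum_(a < m.+2) (lcs I a :&: lcs J (m.+1 - a)))%VS.
  move=> abm; have lta : (a < m.+2)%N by rewrite ltnS -abm leq_addr.
  apply: (sumv_sup (Ordinal lta)) => //=; first by rewrite -abm addKn.
apply: subv_trans (lievS (subvv _) IHn) _; apply/lievP => u w IJu.
case/memv_sumP=> s ws ->; rewrite (linear_sum (lie u)) memv_suml //= => a _.
have := ws a isT; rewrite memv_cap => /andP[Isa Jsa].
have [ix iIx [j Jj ->]] := memv_addP IJu; rewrite lieDl memvD //.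
  apply: (subvP (step n.+1 a.+1 (n.+1 - a)%N _)).
    by rewrite addSn subnKC // -ltnS.
  rewrite memv_cap (subvP (lcs_lie _ hI)) ?memv_lie //=.
  by rewrite (subvP (lcs_ideal _ hJ)) ?memv_lie ?memvf.
apply: (subvP (step n.+1 a (n.+1 - a).+1 _)).
  by rewrite addnS subnKC // -ltnS.
rewrite memv_cap andbC (subvP (lcs_lie _ hJ)) ?memv_lie //=.
by rewrite (subvP (lcs_ideal _ hI)) ?memv_lie ?memvf.
Qed.

Lemma nilradical_max I :
  lie_ideal fullv I -> nilpotent I -> (I <= nilradical)%VS.
Proof.
rewrite /nilradical; case: cid2 => M /= [idM [m /eqP nilM]] maxM idI [n /eqP nilI].
suff nilMI : nilpotent (M + I)%VS.
  by rewrite -(maxM (M + I)%VS) ?addvSl ?addvSr //; split; first exact: lie_idealD.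
exists (m + n).+1; rewrite -subv0; apply: subv_trans (lcs_addv _ idM idI) _.
apply/subv_sumP => a _; have [lema|ltam] := ltnP m a.
  by apply: subv_trans (capvSl _ _) _; rewrite -nilM; apply: (lcs_anti (m := m.+1)).
apply: subv_trans (capvSr _ _) _; rewrite -nilI; apply: (lcs_anti (m := n.+1)) => //.
by rewrite ltn_subRL (leq_ltn_trans (leq_add ltam (leqnn n))) // ltnS leqnSn.
Qed.

End LieTheory.

Arguments solvability_index {K L} U solU.
Arguments nilradical {K} L.
Arguments radical {K} L.
Arguments lie_rad {K} L.
Arguments nilradical_solvable {K} L.
Arguments lie_rad_solvable {K} L.
Arguments lie_subalgf {K} L.

(* Main.v *)
From HB Require Import structures.
Require Import Defs.
From mathcomp Require Import all_boot all_order all_algebra.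
From mathcomp Require Import reals complex.
From mathcomp Require Import boolp sequences exp.

Set Implicit Arguments.
Unset Strict Implicit.
Unset Printing Implicit Defensive.

Import Order.TTheory GRing.Theory Num.Theory VectorInternalTheory.
Local Open Scope ring_scope.

(** Write F and J for the Frattini and Jacobson operators, N for the nilradical
    and K for [L, rad L].

    In a nilpotent algebra U a subalgebra M with M + [U, U] = U is U itself
    ([nilpotent_generated]), so F(U) = J(U) = [U, U] and the iterates of both
    operators are the derived series. The same generation argument, applied to
    N, gives [N, N] <= F(L) for every L. The theorem thus reduces to the
    inclusions F(L) <= J(L) = K <= N, with K nilpotent: for L nonzero, from the
    first step on, the iterates are the derived series of F(L) and of K.

    Nilpotency of K and Cartan's criterion both come from one trace computation
    ([ad_nilpotent_killing]). Let D act as the conjugate of a on the generalized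
    eigenspace of ad x for a. It is a derivation, and tr (ad x D) is the sum of
    the squared moduli of the eigenvalues of ad x; if x is a sum of brackets
    [a, v], this trace is a sum of values of the Killing form, and its vanishing
    makes x ad-nilpotent. Engel's theorem then turns ad-nilpotency into
    nilpotency.

    That J(L) contains K is elementary. For the converse pass to Q = L / K, in
    which solvable ideals are central, and show J(Q) = 0. First, [Q, Q] meets the
    centre trivially ([reductive_derived_central]): any functional of [x, y] has
    the form kappa (D x, y) for the Killing form kappa, the operator D is a
    derivation up to central terms, and it is inner up to central terms. Second,
    if W is the orthogonal of J(Q), then J(Q) + W = Q; as maximal ideals contain
    J(Q), none contains W, and W = Q. Hence J(Q) is isotropic, so central, and it
    vanishes because J(Q) <= [Q, Q].

    Finally F(L) <= J(L) holds as soon as F(L) is an ideal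
    ([frattini_sub_jacobson]). Since F(L) is stable under automorphisms, it is
    stable under both Jordan parts of ad y. The nilpotent part n generates the
    automorphisms exp (t n), polynomial in t. For the semisimple part, the
    operator acting on the generalized eigenspace of a as exp (Re a), or as
    exp (Im a), is an automorphism, and the operators acting as Re a and Im a are
    polynomials in these. *)

(** * Nilpotent algebras and the stabilization indices *)

Section Subspaces.
Variables (K : fieldType) (L : lieAlgType K).
Implicit Types (U V W I J M N A B H : {vspace L}) (x y z : L).

Lemma maximal_above (P : {vspace L} -> Prop) B :
  P B -> exists M, [/\ P M, (B <= M)%VS & forall V, P V -> (M <= V)%VS -> V = M].
Proof.
move=> PB; have [|M PM maxM] := @maximal_ex K L (fun V => P (B + V)%VS).
  by rewrite addv0.
exists (B + M)%VS; split=> // [|V PV sMV]; first exact: addvSl.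
have [sBV sMV'] : (B <= V)%VS /\ (M <= V)%VS by apply/andP; rewrite -subv_add.
have := maxM V; rewrite (addv_idPr sBV) => /(_ PV sMV') eVM.
by rewrite -eVM (addv_idPr sBV).
Qed.

Lemma separating_hyperplane U B x :
    (B <= U)%VS -> x \in U -> x \notin B ->
  exists H, [/\ (B <= H)%VS, (H <= U)%VS, x \notin H &
    forall V, (H <= V)%VS -> (V <= U)%VS -> V = H \/ V = U].
Proof.
move=> sBU Ux nBx.
have [|H [[sBH sHU nHx] _ maxH]] := @maximal_above
    (fun V => [/\ (B <= V)%VS, (V <= U)%VS & x \notin V]) B; first by rewrite subvv.
exists H; split=> // V sHV sVU.
have [Vx|nVx] := boolP (x \in V); last first.
  by left; apply: maxH; rewrite ?(subv_trans sBH).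
right; apply: subv_anti; rewrite sVU /=; apply/subvP => u Uu.
have [Hu|nHu] := boolP (u \in H); first by rewrite (subvP sHV).
have [Hux|nHux] := boolP (x \in H + <[u]>)%VS; last first.
  case/negP: nHu; suff <- : (H + <[u]>)%VS = H.
    by rewrite (subvP (addvSr _ _)) ?memv_line.
  apply: maxH (addvSl _ _); split=> //; first exact: subv_trans sBH (addvSl _ _).
  by rewrite subv_add sHU -memvE.
have [h Hh [_ /vlineP[c ->] def_x]] := memv_addP Hux.
have nz_c : c != 0.
  by apply: contraNneq nHx => c0; rewrite def_x c0 scale0r addr0.
have -> : u = c^-1 *: (x - h) by rewrite def_x addrC addKr scalerA mulVf // scale1r.
by rewrite memvZ ?memvB // (subvP sHV).
Qed.

Lemma lie_ideal_refl U : lie_subalg U -> lie_ideal U U.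
Proof. by move=> sU; rewrite /lie_ideal subvv. Qed.

Lemma sub_derived_subalg U M :
  (liev U U <= M)%VS -> (M <= U)%VS -> lie_subalg M.
Proof. by move=> sUM sMU; apply: subv_trans sUM; apply: lievS. Qed.

Lemma sub_derived_ideal U M :
  (liev U U <= M)%VS -> (M <= U)%VS -> lie_ideal U M.
Proof.
by move=> sUM sMU; rewrite /lie_ideal sMU (subv_trans _ sUM) // lievS.
Qed.

(** A nilpotent algebra is generated by any subspace spanning it modulo [U, U]. *)
Lemma nilpotent_generated U M : lie_subalg U -> nilpotent U -> lie_subalg M ->
  (M <= U)%VS -> (U <= M + liev U U)%VS -> (U <= M)%VS.
Proof.
move=> sU [n /eqP Un] sM sMU sUM.
suff h k : (U <= M + lower_central k U)%VS by have := h n; rewrite Un addv0.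
elim: k => [|k IHk] /=; first exact: addvSr.
set V := lower_central k U in IHk *; have sVU : (V <= U)%VS := lower_central_sub k sU.
apply: subv_trans sUM _; rewrite subv_add addvSl /=.
apply: subv_trans (lievS IHk IHk) _; apply: subv_trans (lievDr _ _ _) _.
rewrite subv_add; apply/andP; split; last first.
  by apply: subv_trans (addvSr _ _); apply: lievS; rewrite // subv_add sMU.
apply: subv_trans (lievDl _ _ _) _; apply: addvS => //.
by rewrite liev_sym lievS.
Qed.

Lemma maximal_subalg_nilpotent U M : lie_subalg U -> nilpotent U ->
  maximal_subalg U M -> (liev U U <= M)%VS.
Proof.
move=> sU nU [sM sMU neMU maxM].
have sMUU : (M + liev U U <= U)%VS by rewrite subv_add sMU; apply: sU.
have [||//|e|e] := maxM (M + liev U U)%VS.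
- exact: sub_derived_subalg (addvSr _ _) sMUU.
- exact: addvSl.
- by rewrite -e addvSr.
- case/negP: neMU; rewrite eqEsubv sMU /=.
  by apply: nilpotent_generated => //; rewrite e.
Qed.

Lemma maximal_ideal_nilpotent U M : lie_subalg U -> nilpotent U ->
  maximal_ideal U M -> (liev U U <= M)%VS.
Proof.
move=> sU nU [iM neMU maxM]; have [sMU _] := andP iM.
have sMUU : (M + liev U U <= U)%VS by rewrite subv_add sMU; apply: sU.
have [||e|e] := maxM (M + liev U U)%VS.
- exact: sub_derived_ideal (addvSr _ _) sMUU.
- exact: addvSl.
- by rewrite -e addvSr.
- case/negP: neMU; rewrite eqEsubv sMU /=.
  by apply: nilpotent_generated; rewrite ?e ?(lie_ideal_subalg iM).
Qed.

(** The subspaces of codimension one above [U, U] are both maximal subalgebras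
    and maximal ideals of U, and they intersect in [U, U]. *)
Lemma maximal_above_derived U x : lie_subalg U -> x \in U -> x \notin liev U U ->
  exists H, [/\ maximal_subalg U H, maximal_ideal U H & x \notin H].
Proof.
move=> sU Ux nx; have [H [sBH sHU nHx maxH]] := separating_hyperplane sU Ux nx.
have neHU : H != U by apply: contraNneq nHx => ->.
exists H; split=> //; split=> //.
- exact: sub_derived_subalg sBH sHU.
- by move=> V _; apply: maxH.
- exact: sub_derived_ideal sBH sHU.
- by move=> V /andP[sVU _] sHV; apply: maxH.
Qed.

Lemma frattini_sub_derived U : lie_subalg U -> (frattini U <= liev U U)%VS.
Proof.
move=> sU; apply/subvP => x /memv_bigcap[Ux Fx].
have [//|/(maximal_above_derived sU Ux)[H [mH _ /negP[]]]] := boolP (x \in liev U U).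
exact: Fx.
Qed.

Lemma jacobson_sub_derived U : lie_subalg U -> (jacobson U <= liev U U)%VS.
Proof.
move=> sU; apply/subvP => x /memv_bigcap[Ux Fx].
have [//|/(maximal_above_derived sU Ux)[H [_ mH /negP[]]]] := boolP (x \in liev U U).
exact: Fx.
Qed.

Lemma frattini_nilpotent U : lie_subalg U -> nilpotent U -> frattini U = liev U U.
Proof.
move=> sU nU; apply: subv_anti; rewrite frattini_sub_derived //=.
apply/subvP => x Ux; apply/memv_bigcap; split; first exact: subvP sU _ Ux.
by move=> M /(maximal_subalg_nilpotent sU nU)/subvP; apply.
Qed.

Lemma jacobson_nilpotent U : lie_subalg U -> nilpotent U -> jacobson U = liev U U.
Proof.
move=> sU nU; apply: subv_anti; rewrite jacobson_sub_derived //=.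
apply/subvP => x Ux; apply/memv_bigcap; split; first exact: subvP sU _ Ux.
by move=> M /(maximal_ideal_nilpotent sU nU)/subvP; apply.
Qed.

Lemma derived_subalg n U : lie_subalg U -> lie_subalg (derived n U).
Proof. by move=> sU; case: n => // n; elim: n => [|n IHn]; apply/lievS. Qed.

Lemma derived_sub n U : lie_subalg U -> (derived n U <= U)%VS.
Proof.
move=> sU; elim: n => [|n IHn]; first exact: subvv.
exact: subv_trans (derived_subalg n sU) IHn.
Qed.

Lemma lower_centralS n U V : (U <= V)%VS ->
  (lower_central n U <= lower_central n V)%VS.
Proof. by move=> sUV; elim: n => //= n IHn; apply: lievS. Qed.

Lemma nilpotentS U V : (U <= V)%VS -> nilpotent V -> nilpotent U.
Proof.
by move=> sUV [n /eqP Vn]; exists n; rewrite -subv0 -Vn lower_centralS.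
Qed.

Lemma iter_frattini_nilpotent U n : lie_subalg U -> nilpotent U ->
  iter n (@frattini K L) U = derived n U.
Proof.
move=> sU nU; elim: n => //= n ->; apply: frattini_nilpotent.
  exact: derived_subalg.
by apply: nilpotentS nU; apply: derived_sub.
Qed.

Lemma iter_jacobson_nilpotent U n : lie_subalg U -> nilpotent U ->
  iter n (@jacobson K L) U = derived n U.
Proof.
move=> sU nU; elim: n => //= n ->; apply: jacobson_nilpotent.
  exact: derived_subalg.
by apply: nilpotentS nU; apply: derived_sub.
Qed.

Lemma ideal_liev I J : lie_ideal fullv I -> lie_ideal fullv J ->
  lie_ideal fullv (liev I J).
Proof.
move=> /andP[_ iI] /andP[_ iJ]; rewrite /lie_ideal subvf /=.
by apply: subv_trans (liev_leibniz _ _ _) _; rewrite subv_add !lievS.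
Qed.

Lemma derived_stable n U : solvable U ->
  (derived n.+1 U == derived n U) = (derived n U == 0%VS).
Proof.
move=> [m /eqP Um]; apply/eqP/eqP => [e|/= ->]; last by rewrite liev0.
have e_ k : derived (k + n) U = derived n U.
  by elim: k => //= k IHk; rewrite IHk -[RHS]e.
rewrite -(e_ m) /derived addnC iterD -!/(derived _ _) Um.
by elim: n {e e_} => //= n ->; rewrite liev0.
Qed.

Lemma solvability_index_leq U (solU : solvable U) n :
  (solvability_index U solU <= n)%N = (derived n U == 0%VS).
Proof.
rewrite /solvability_index; case: ex_minnP => m /eqP Um minm.
apply/idP/idP => [/subnK <- | /minm //].
rewrite /derived iterD -!/(derived _ _) Um.
by elim: (n - m)%N => //= k /eqP ->; rewrite liev0.
Qed.

(** The first stationary iterate of f from L on, when these iterates are the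
    derived series of L. *)
Lemma stable_index_derived (f : {vspace L} -> {vspace L})
    (exU : exists n, iter n.+1 f {:L}%VS == iter n f {:L}%VS)
    (solL : solvable {:L}%VS) :
    (forall n, iter n f {:L}%VS = derived n {:L}%VS) ->
  ex_minn exU = solvability_index _ solL.
Proof.
move=> fE; case: ex_minnP => m; rewrite !fE derived_stable // => Lm minm.
apply/eqP; rewrite eqn_leq solvability_index_leq Lm andbT.
by apply: minm; rewrite !fE derived_stable // -(solvability_index_leq solL).
Qed.

(** The same when the first iterate is a proper subspace A, and the next ones its
    derived series. *)
Lemma stable_index_derived_step (f : {vspace L} -> {vspace L}) A
    (exU : exists n, iter n.+1 f {:L}%VS == iter n f {:L}%VS)
    (solA : solvable A) :
  A != {:L}%VS -> (forall n, iter n.+1 f {:L}%VS = derived n A) ->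
  ex_minn exU = (solvability_index A solA).+1.
Proof.
move=> neA fE; case: ex_minnP => [[|m]]; first by rewrite fE /= (negPf neA).
rewrite !fE derived_stable // => Am minm.
apply/eqP; rewrite eqSS eqn_leq solvability_index_leq Am andbT.
rewrite -ltnS; apply: minm.
by rewrite !fE derived_stable // -(solvability_index_leq solA).
Qed.

Lemma frattini_proper : {:L}%VS != 0%VS -> frattini {:L}%VS != {:L}%VS.
Proof.
move=> nzL; have [|M [[sM neM] _ maxM]] := @maximal_above
   (fun V => lie_subalg V /\ V != {:L}%VS) 0%VS.
  by rewrite /lie_subalg liev0 eq_sym.
apply: contraNneq (neM) => eF; rewrite eqEsubv subvf -{1}eF.
apply/subvP => x /memv_bigcap[_]; apply; split; rewrite ?subvf // => V sV sMV _.
have [->|neV] := eqVneq V {:L}%VS; first by right.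
by left; apply: maxM.
Qed.

(** If a maximal subalgebra M does not contain [N, N], then L = M + [N, N], so
    that M :&: N generates N, and N <= M after all. *)
Lemma derived_nilpotent_ideal_sub_frattini N : lie_ideal fullv N -> nilpotent N ->
  (liev N N <= frattini {:L}%VS)%VS.
Proof.
move=> iN nN; have iNN := ideal_liev iN iN; have sN := lie_ideal_subalg iN.
apply/subvP => x NNx; apply/memv_bigcap; split=> [|M [sM _ neM maxM]].
  exact: memvf.
have [||||e] := maxM (M + liev N N)%VS; rewrite ?addvSl ?subvf //.
- apply: subv_trans (lievDr _ _ _) _; rewrite subv_add; apply/andP; split.
    apply: subv_trans (lievDl _ _ _) _; apply: addvS; first exact: sM.
    by rewrite liev_sym; apply: subv_trans (proj2 (andP iNN)); apply/lievS/subvv/subvf.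
  apply: subv_trans (addvSr _ _); apply: subv_trans (proj2 (andP iNN)).
  exact/lievS/subvv/subvf.
- by move=> <-; rewrite (subvP (addvSr _ _)).
suff sNM : (N <= M)%VS by rewrite (subvP sNM) // (subvP sN).
suff : (N <= M :&: N)%VS by rewrite subv_cap => /andP[].
apply: nilpotent_generated nN _ _ _ => //.
- rewrite /lie_subalg subv_cap; apply/andP; split.
    by apply: subv_trans sM; apply: lievS; apply: capvSl.
  by apply: subv_trans sN; apply: lievS; apply: capvSr.
- exact: capvSr.
by rewrite addvC vspace_modl ?[(_ + M)%VS]addvC ?e ?capfv.
Qed.

End Subspaces.

(** * Polynomials in an endomorphism and its generalized eigenspaces *)

Lemma is_trig_mxM (R : nzRingType) n (A B : 'M[R]_n) :
    is_trig_mx A -> is_trig_mx B ->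
  is_trig_mx (A *m B) /\ forall i, (A *m B) i i = A i i * B i i.
Proof.
move=> /is_trig_mxP tA /is_trig_mxP tB; split=> [|i].
  apply/is_trig_mxP => i j ltij; rewrite mxE big1 // => k _.
  have [ltik|leki] := ltnP i k; first by rewrite tA ?mul0r.
  by rewrite tB ?mulr0 // (leq_ltn_trans leki).
rewrite mxE (bigD1 i) //= big1 ?addr0 // => k neki.
have [ltik|leki] := ltnP i k; first by rewrite tA ?mul0r.
by rewrite tB ?mulr0 // ltn_neqAle leki andbT.
Qed.

Lemma is_trig_horner (R : comNzRingType) n (A : 'M[R]_n.+1) p : is_trig_mx A ->
  is_trig_mx (horner_mx A p) /\ forall i, (horner_mx A p) i i = p.[A i i].
Proof.
move=> tA; elim/poly_ind: p => [|p c [IHt IHd]].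
  by rewrite rmorph0 mx0_is_trig; split=> // i; rewrite mxE horner0.
rewrite rmorphD rmorphM /= horner_mx_X horner_mx_C.
have [tpA dpA] := is_trig_mxM IHt tA; split=> [|i].
  apply/is_trig_mxP => i j ltij; rewrite mxE (is_trig_mxP tpA) // add0r.
  by rewrite mxE -val_eqE ltn_eqF.
by rewrite hornerMXaddC mxE [X in X + _]dpA IHd mxE eqxx.
Qed.

(** The diagonal of a Schur triangular form of A, seen through polynomials. *)
Lemma schur_calculus (C : numClosedFieldType) n (A : 'M[C]_n.+1) :
  exists s : seq C, [/\ horner_mx A (\prod_(a <- s) ('X - a%:P)) = 0,
    forall p, \tr (horner_mx A p) = \sum_(a <- s) p.[a] &
    forall p, horner_mx A p = 0 -> forall a, a \in s -> p.[a] = 0].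
Proof.
have [//|P uP] := @Schur C _ A _; have {}uP := unitarymx_unit uP.
rewrite /similar_to conjumx //; set T := P *m A *m _ => tT.
have TA p : horner_mx T p = P *m horner_mx A p *m invmx P by exact: horner_mx_uconj.
exists [seq T i i | i <- enum 'I_n.+1]; split=> [|p|p pA _ /mapP[i _ ->]].
- rewrite big_map big_enum -char_poly_trig //.
  have := Cayley_Hamilton T; rewrite TA => /(congr1 (fun B => invmx P *m B *m P)).
  by rewrite mulmx0 mul0mx !mulmxA mulVmx // mul1mx mulmxKV.
- rewrite big_map big_enum.
  have -> : \tr (horner_mx A p) = \tr (horner_mx T p).
    by rewrite TA mxtrace_mulC mulmxA mulVmx // mul1mx.
  by apply: eq_bigr => i _; rewrite (is_trig_horner p tT).2.
- by rewrite -(is_trig_horner p tT).2 TA pA mulmx0 mul0mx mxE.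
Qed.

Section MatrixPolynomial.
Variables (C : numClosedFieldType) (n : nat).
Implicit Types (A : 'M[C]_n) (p q : {poly C}).

(** The value of p at A, for a square matrix A of any size; only matrices of
    positive size form the nonzero ring which [horner_mx] requires. *)
Definition mxact A p : 'M[C]_n :=
  (if n is m.+1 return 'M_n -> 'M_n then horner_mx^~ p else id) A.

End MatrixPolynomial.

Lemma mxact_rmorph (C : numClosedFieldType) n (A : 'M[C]_n) :
  [/\ forall p q, mxact A (p + q) = mxact A p + mxact A q,
      forall p q, mxact A (p * q) = mxact A p *m mxact A q,
      forall a, mxact A a%:P = a%:M & mxact A 'X = A].
Proof.
case: n A => [|n] A; first by split=> *; rewrite [LHS]thinmx0 [RHS]thinmx0.
by split=> [p q|p q|a|]; rewrite /= ?rmorphD ?rmorphM ?horner_mx_C ?horner_mx_X.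
Qed.

Lemma mxact_schur (C : numClosedFieldType) n (A : 'M[C]_n) :
  exists s : seq C, [/\ mxact A (\prod_(a <- s) ('X - a%:P)) = 0,
    forall p, \tr (mxact A p) = \sum_(a <- s) p.[a] &
    forall p, mxact A p = 0 -> forall a, a \in s -> p.[a] = 0].
Proof.
case: n A => [|n] A; last exact: schur_calculus.
by exists [::]; split=> // [|p]; rewrite [mxact _ _]thinmx0 // mxtrace0 big_nil.
Qed.

Section FunctionalCalculus.
Variables (C : numClosedFieldType) (V : vectType C).
Implicit Types (f g : 'End(V)) (U : {vspace V}) (v w : V) (p q : {poly C}) (a b : C).

(** The trace of an endomorphism. *)
Definition lfun_tr f : C := \tr (f2mx f).

Lemma v2r_lfun f v : v2r (f v) = v2r v *m f2mx f.
Proof. by rewrite unlock /= r2vK. Qed.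

Lemma f2mx_comp f g : f2mx (f \o g)%VF = f2mx g *m f2mx f.
Proof.
apply/row_matrixP => i; rewrite -[f2mx f]/(f2mx f) !rowE mulmxA.
by rewrite -[delta_mx 0 i](r2vK (vT := V)) -!v2r_lfun comp_lfunE.
Qed.

Lemma lfun_trC f g : lfun_tr (f \o g)%VF = lfun_tr (g \o f)%VF.
Proof. by rewrite /lfun_tr !f2mx_comp mxtrace_mulC. Qed.

Lemma lfun_trP a f g : lfun_tr (a *: f + g) = a * lfun_tr f + lfun_tr g.
Proof.
rewrite /lfun_tr -mxtraceZ -mxtraceD; congr (\tr _).
apply/row_matrixP => i; rewrite !rowE.
rewrite -[delta_mx 0 i](r2vK (vT := V)) mulmxDr -scalemxAr -!v2r_lfun.
by rewrite add_lfunE scale_lfunE linearP.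
Qed.

Lemma lfun_tr0 : lfun_tr 0 = 0.
Proof. by have := lfun_trP (-1) 0 0; rewrite scaler0 addr0 mulN1r addNr. Qed.

Lemma lfun_trD f g : lfun_tr (f + g) = lfun_tr f + lfun_tr g.
Proof. by have := lfun_trP 1 f g; rewrite scale1r mul1r. Qed.

Lemma lfun_trZ a f : lfun_tr (a *: f) = a * lfun_tr f.
Proof. by have := lfun_trP a f 0; rewrite lfun_tr0 !addr0. Qed.

Lemma lfun_trN f : lfun_tr (- f) = - lfun_tr f.
Proof. by rewrite -scaleN1r lfun_trZ mulN1r. Qed.

Lemma lfun_trB f g : lfun_tr (f - g) = lfun_tr f - lfun_tr g.
Proof. by rewrite lfun_trD lfun_trN. Qed.

(** The endomorphism p(f). *)
Definition pact f p : 'End(V) := Hom (mxact (f2mx f) p).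

Lemma pactE f p v : pact f p v = r2v (v2r v *m mxact (f2mx f) p).
Proof. by rewrite -[LHS]v2rK v2r_lfun. Qed.

Lemma pactD f p q v : pact f (p + q) v = pact f p v + pact f q v.
Proof.
by have [mxD _ _ _] := mxact_rmorph (f2mx f); rewrite !pactE mxD mulmxDr linearD.
Qed.

Lemma pactC f a v : pact f a%:P v = a *: v.
Proof.
have [_ _ mxC _] := mxact_rmorph (f2mx f).
by rewrite pactE mxC mul_mx_scalar linearZ /= v2rK.
Qed.

Lemma pactX f v : pact f 'X v = f v.
Proof.
by have [_ _ _ mxX] := mxact_rmorph (f2mx f); rewrite pactE mxX -v2r_lfun v2rK.
Qed.

Lemma pactM f p q v : pact f (p * q) v = pact f p (pact f q v).
Proof.
have [_ mxM _ _] := mxact_rmorph (f2mx f).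
by rewrite mulrC !pactE mxM mulmxA r2vK.
Qed.

Lemma pactN f p v : pact f (- p) v = - pact f p v.
Proof. by rewrite -mulN1r -[-1 in LHS]polyCN pactM pactC scaleN1r. Qed.

Lemma pactB f p q v : pact f (p - q) v = pact f p v - pact f q v.
Proof. by rewrite pactD pactN. Qed.

Lemma pact1 f v : pact f 1 v = v.
Proof. by rewrite -[1]/(1%:P) pactC scale1r. Qed.

Lemma pactZ f a p v : pact f (a *: p) v = a *: pact f p v.
Proof. by rewrite -mul_polyC pactM pactC. Qed.

Lemma pact_sum f (X : Type) (r : seq X) (P : pred X) (F : X -> {poly C}) v :
  pact f (\sum_(i <- r | P i) F i) v = \sum_(i <- r | P i) pact f (F i) v.
Proof.
apply: (big_morph (fun p => pact f p v)) => [p q|]; first exact: pactD.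
by rewrite -[0]/(0%:P) pactC scale0r.
Qed.

Lemma pactXn f k v : pact f 'X^k v = iter k f v.
Proof. by elim: k => [|k IHk]; rewrite ?expr0 ?pact1 // exprS pactM IHk pactX. Qed.

Lemma pact_eigen f p a v : f v = a *: v -> pact f p v = p.[a] *: v.
Proof.
move=> fv; elim/poly_ind: p => [|p c IHp]; first by rewrite -[0]/(0%:P) pactC hornerC.
rewrite hornerMXaddC pactD [p * _]mulrC pactM pactX pactC IHp.
by rewrite linearZ /= fv scalerA scalerDl.
Qed.

Lemma pact_stable f p U :
  {in U, forall v, f v \in U} -> {in U, forall v, pact f p v \in U}.
Proof.
move=> fU v Uv; elim/poly_ind: p => [|p c IHp].
  by rewrite -[0]/(0%:P) pactC scale0r mem0v.
by rewrite pactD mulrC pactM pactX pactC memvD ?fU // memvZ.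
Qed.

(** The generalized eigenspace of f for a, as a predicate. *)
Definition geigen f a v := exists k, pact f (('X - a%:P) ^+ k) v = 0.

(** s lists the eigenvalues of f with multiplicities, as expressed by the three
    properties of the list used below: the product of the 'X - a annihilates f,
    tr p(f) is the sum of the p(a), and every polynomial annihilating f vanishes
    on s. *)
Definition spectrum_of f (s : seq C) :=
  [/\ forall v, pact f (\prod_(a <- s) ('X - a%:P)) v = 0,
    forall p, lfun_tr (pact f p) = \sum_(a <- s) p.[a] &
    forall p, (forall v, pact f p v = 0) -> forall a, a \in s -> p.[a] = 0].

Lemma spectrum_ex f : exists s, spectrum_of f s.
Proof.
have [s [s0 str sroot]] := mxact_schur (f2mx f); exists s; split=> [v|//|p p0].
  by rewrite pactE s0 mulmx0 linear0.
apply: sroot; apply/row_matrixP => i; rewrite row0 rowE.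
by rewrite -[delta_mx 0 i](r2vK (vT := V)) -(v2r_lfun (pact f p)) p0 linear0.
Qed.

Lemma lfun_tr_nilpotent f k : (forall v, iter k f v = 0) -> lfun_tr f = 0.
Proof.
move=> fk0; have [s [_ str sroot]] := spectrum_ex f.
have -> : f = pact f 'X by apply/lfunP => v; rewrite pactX.
rewrite str big_seq big1 // => a sa; rewrite hornerX; apply/eqP.
have := sroot 'X^k _ a sa; rewrite hornerXn => /(_ _)/eqP; rewrite expf_eq0 => h.
by have [v|_ -> //] := andP (h _); rewrite pactXn.
Qed.

Lemma coprimep_pact0 f p q v :
  coprimep p q -> pact f p v = 0 -> pact f q v = 0 -> v = 0.
Proof.
move=> /Bezout_eq1_coprimepP[[a b] /= ab1] pv qv.
by rewrite -(pact1 f v) -ab1 pactD !pactM pv qv !linear0 addr0.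
Qed.

Lemma coprimep_pact_split f p q v : coprimep p q -> pact f (p * q) v = 0 ->
  exists v1 v2, [/\ v = v1 + v2, pact f p v1 = 0 & pact f q v2 = 0].
Proof.
move=> /Bezout_eq1_coprimepP[[a b] /= ab1] pqv.
exists (pact f (b * q) v), (pact f (a * p) v); split.
- by rewrite -pactD addrC ab1 pact1.
- by rewrite -pactM mulrCA pactM pqv linear0.
- by rewrite -pactM mulrCA [q * p]mulrC pactM pqv linear0.
Qed.

Lemma coprimep_XsubC_prod a (s : seq C) k : a \notin s ->
  coprimep (('X - a%:P) ^+ k) (\prod_(b <- s) ('X - b%:P) ^+ k).
Proof.
elim: s => [|b s IHs]; first by rewrite big_nil coprimep1.
rewrite inE negb_or big_cons coprimepMr => /andP[neab /IHs->]; rewrite andbT.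
by apply/coprimep_expl/coprimep_expr/coprimep_XsubC2; rewrite subr_eq0 eq_sym.
Qed.

(** V is spanned by the generalized eigenvectors of f, as an induction principle. *)
Lemma geigen_ind f (P : V -> Prop) : P 0 -> (forall v w, P v -> P w -> P (v + w)) ->
  (forall a v, geigen f a v -> P v) -> forall v, P v.
Proof.
move=> P0 PD Pg v; have [s [s0 _ _]] := spectrum_ex f.
have : pact f (\prod_(b <- undup s) ('X - b%:P) ^+ size s) v = 0.
  have /dvdpP[q ->] : \prod_(b <- s) ('X - b%:P) %|
      \prod_(b <- undup s) ('X - b%:P) ^+ size s.
    rewrite prodrXl; set Q := \prod_(b <- undup s) _.
    have : {in s, forall b, 'X - b%:P %| Q}.
      by move=> b sb; rewrite /Q (big_rem b) ?mem_undup //= dvdp_mulr.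
    elim: (s) => [|b r IHr] sQ; first by rewrite big_nil dvd1p.
    rewrite big_cons exprS dvdp_mul ?sQ ?mem_head // IHr // => c rc.
    by rewrite sQ // in_cons rc orbT.
  by rewrite pactM s0 linear0.
elim: (undup s) (undup_uniq s) v => [_|a r IHr /= /andP[nra ur]] v.
  by rewrite big_nil pact1 => ->.
rewrite big_cons => /(coprimep_pact_split (coprimep_XsubC_prod _ nra)).
move=> [v1 [v2 [-> v1_0 v2_0]]]; apply: PD; last exact: (IHr ur).
by apply: (Pg a); exists (size s).
Qed.

(** Chinese remaindering with moduli ('X - a) ^+ N. *)
Lemma poly_interpolation (u : C -> C) N (s : seq C) :
  exists g : {poly C}, forall a, a \in s -> ('X - a%:P) ^+ N %| g - (u a)%:P.
Proof.
suff : exists g : {poly C}, forall a, a \in undup s -> ('X - a%:P) ^+ N %| g - (u a)%:P.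
  by case=> g gP; exists g => a; rewrite -mem_undup; apply: gP.
elim: (undup s) (undup_uniq s) => [_|a r IHr /= /andP[nra /IHr[g gP]]].
  by exists 0.
have /Bezout_eq1_coprimepP[[x y] /= xy1] := coprimep_XsubC_prod N nra.
exists (g + ((u a)%:P - g) * (y * \prod_(b <- r) ('X - b%:P) ^+ N)); move=> b.
rewrite inE; case: (eqVneq b a) => [-> _|neba /= rb].
  have -> : y * \prod_(b <- r) ('X - b%:P) ^+ N = 1 - x * ('X - a%:P) ^+ N.
    by rewrite -[1 in RHS]xy1 addrAC subrr add0r.
  rewrite mulrBr mulr1 addrA [g + _]addrC subrK addrAC subrr add0r -mulNr.
  by rewrite mulrA dvdp_mull.
rewrite addrAC dvdp_add ?gP //; apply/dvdp_mull/dvdp_mull.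
by rewrite (big_rem b) //= dvdp_mulr.
Qed.

(** On generalized eigenvectors a uniform exponent suffices, and there are none
    outside the spectrum. *)
Lemma geigen_bound f s a v k : spectrum_of f s -> geigen f a v ->
  (size s <= k)%N -> pact f (('X - a%:P) ^+ k) v = 0 /\ (a \notin s -> v = 0).
Proof.
move=> [s0 _ _] [j av0] lesk.
have [m [q nqa def_p]] := multiplicity_XsubC (\prod_(b <- s) ('X - b%:P)) a.
have nzp : \prod_(b <- s) ('X - b%:P) != 0 by rewrite monic_neq0 // monic_prod_XsubC.
rewrite nzp /= in nqa.
have lemk : (m <= k)%N.
  apply: leq_trans lesk; rewrite -ltnS -(size_prod_XsubC s id) def_p.
  have nzq : q != 0 by apply: contraNneq nqa => ->; rewrite root0.
  rewrite size_Mmonic ?monic_exp ?monicXsubC // size_exp_XsubC addnS /=.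
  by rewrite -add1n leq_add2r size_poly_gt0.
have mv0 : pact f (('X - a%:P) ^+ m) v = 0.
  apply: (@coprimep_pact0 f (('X - a%:P) ^+ j) q).
  - by rewrite coprimep_expl // coprimep_sym coprimep_XsubC.
  - by rewrite -pactM mulrC pactM av0 linear0.
  - by rewrite -pactM -def_p.
split=> [|nsa]; first by rewrite -(subnK lemk) exprD pactM mv0 linear0.
suff m0 : m = 0%N by rewrite -mv0 m0 expr0 pact1.
apply/eqP; rewrite -leqn0 leqNgt; apply: contra nsa => m_gt0.
by rewrite -root_prod_XsubC def_p rootM -(prednK m_gt0) root_exp_XsubC eqxx orbT.
Qed.

(** u(f): the endomorphism acting on each generalized eigenspace of f as the
    scalar assigned by u to its eigenvalue. It is a polynomial in f, divisible by
    'X ^+ 2 when u 0 = 0; for u the conjugation, tr (f D) is the sum of the squared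
    moduli of the eigenvalues of f. *)
Lemma spectral_calculus f (u : C -> C) : exists D : 'End(V),
  [/\ forall a v, geigen f a v -> D v = u a *: v,
      u 0 = 0 -> forall U, {in U, forall v, f v \in U} ->
        {in U, forall v, exists2 w, w \in U & D v = f (f w)} &
      (forall a, u a = a^*) -> lfun_tr (f \o D)%VF = 0 ->
        exists k, forall v, iter k f v = 0].
Proof.
have [s sP] := spectrum_ex f; have [s0 str _] := sP.
(* The exponent exceeds size s by 2, so that 'X ^+ 2 divides g when u 0 = 0. *)
have [g gP] := poly_interpolation u (size s).+2 (0 :: s).
exists (pact f g); split; first 1 last.
- move=> u0 U fU v Uv; have := gP 0 (mem_head _ _).
  rewrite u0 !subr0 => /dvdpP[q def_g].
  exists (pact f ('X ^+ size s * q) v); first exact: pact_stable.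
  rewrite def_g -!(pactX f) -!pactM; congr (pact f _ v).
  by rewrite !exprS mulrC -!mulrA.
- move=> uE; have -> : (f \o pact f g)%VF = pact f ('X * g).
    by apply/lfunP => v; rewrite comp_lfunE pactM pactX.
  rewrite str => tr0; exists (size s) => v.
  have {}tr0 : \sum_(a <- s) `|a| ^+ 2 = 0.
    rewrite -[RHS]tr0 big_seq [RHS]big_seq; apply: eq_bigr => a sa.
    rewrite hornerM hornerX normCK -uE; congr (a * _); apply/eqP.
    have /dvdpP[q] := gP a (mem_behead (s := 0 :: s) sa).
    move/eqP; rewrite subr_eq => /eqP ->; rewrite hornerD hornerM hornerC.
    by rewrite horner_exp hornerXsubC subrr expr0n mulr0 add0r.
  have s_0 a : a \in s -> a = 0.
    move=> sa; move/eqP: tr0; rewrite psumr_eq0 => [/allP/(_ a sa)|*].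
      by rewrite expf_eq0 normr_eq0 => /eqP.
    exact: exprn_ge0.
  rewrite -pactXn -[RHS](s0 v); congr (pact f _ v).
  rewrite (eq_big_seq (fun=> 'X)) ?big_const_seq ?count_predT.
    by rewrite -Monoid.iteropE.
  by move=> a /s_0 ->; rewrite subr0.
- move=> a v av; have [av0 ns] := geigen_bound sP av (leq_addr 2 _).
  have [sa|/ns ->] := boolP (a \in s); last by rewrite scaler0 linear0.
  have /dvdpP[q] : ('X - a%:P) ^+ (size s).+2 %| g - (u a)%:P.
    by rewrite gP // inE sa orbT.
  move/eqP; rewrite subr_eq => /eqP ->.
  by rewrite pactD pactM -addn2 av0 linear0 add0r pactC.
Qed.

End FunctionalCalculus.

(** * Engel's theorem *)

Section Engel.
Variables (K : fieldType) (L : lieAlgType K).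
Implicit Types (U V W I J M N A B H : {vspace L}) (x y z : L).

Lemma lieZr a x y : lie x (a *: y) = a *: lie x y.
Proof. exact: linearZ. Qed.

Lemma lieZl a x y : lie (a *: x) y = a *: lie x y.
Proof. exact: (linearZ_LR (lier y)). Qed.

Lemma lie0l y : lie 0 y = 0.
Proof. exact: (linear0 (lier y)). Qed.

Lemma lie0r x : lie x 0 = 0.
Proof. exact: linear0. Qed.

Lemma lieBr x y z : lie x (y - z) = lie x y - lie x z.
Proof. exact: linearB. Qed.

Lemma lieBl x y z : lie (x - y) z = lie x z - lie y z.
Proof. exact: (linearB (lier z)). Qed.

Lemma lie_suml (X : Type) (r : seq X) (P : pred X) (F : X -> L) y :
  lie (\sum_(i <- r | P i) F i) y = \sum_(i <- r | P i) lie (F i) y.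
Proof. exact: (linear_sum (lier y)). Qed.

Lemma lie_sumr (X : Type) (r : seq X) (P : pred X) (F : X -> L) x :
  lie x (\sum_(i <- r | P i) F i) = \sum_(i <- r | P i) lie x (F i).
Proof. exact: linear_sum. Qed.

Lemma liev_ind (P : L -> Prop) U V : P 0 ->
    (forall a x y, P x -> P y -> P (a *: x + y)) ->
    {in U & V, forall u v, P (lie u v)} ->
  {in liev U V, forall x, P x}.
Proof.
move=> P0 PD PUV x; rewrite /liev; set s := allpairs _ _ _.
have Ps y : y \in s -> P y.
  by move=> /allpairsP[[u v] /= [Uu Vv ->]]; apply: PUV; apply: vbasis_mem.
rewrite -[s]/(tval (in_tuple s)) => /coord_span ->.
apply: big_ind => // [y z Py Pz|i _]; first by rewrite -[y]scale1r; apply: PD.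
by rewrite -[_ *: _]addr0; apply: PD => //; apply/Ps/mem_nth.
Qed.

(** ad x is nilpotent. *)
Definition ad_nilpotent x := exists k, forall v, iter k (lie x) v = 0.

Lemma liev_line x U : (liev <[x]> U <= linfun (lie x) @: U)%VS.
Proof.
apply/lievP => _ v /vlineP[c ->] Uv; rewrite -/(lier v (c *: x)) linearZ /lier /=.
by rewrite memvZ //; apply/memv_imgP; exists v; rewrite ?lfunE.
Qed.

Lemma iter_liev_line x U k :
  {in iter k (liev <[x]>) U, forall w, exists2 u, u \in U & w = iter k (lie x) u}.
Proof.
elim: k => [w Uw|k IHk w]; first by exists w.
move/(subvP (liev_line _ _))/memv_imgP => [v /IHk[u Uu ->] ->].
by exists u; rewrite ?lfunE.
Qed.

Lemma iter_lievS k U V1 V2 : (V1 <= V2)%VS ->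
  (iter k (liev U) V1 <= iter k (liev U) V2)%VS.
Proof. by move=> sV; elim: k => //= k IHk; apply: lievS. Qed.

Lemma iter_liev_sub k U V : (liev U V <= V)%VS -> (iter k (liev U) V <= V)%VS.
Proof.
move=> sV; elim: k => [|k IHk]; first exact: subvv.
exact: subv_trans (lievS (subvv U) IHk) sV.
Qed.

(** Engel's theorem: a subalgebra all of whose elements are ad-nilpotent acts
    nilpotently on L. *)
Theorem engel H : lie_subalg H -> {in H, forall x, ad_nilpotent x} ->
  exists k, iter k (liev H) {:L}%VS = 0%VS.
Proof.
have [n] := ubnP (\dim H); elim: n H => // n IHn H; rewrite ltnS => leHn sH nilH.
have [H0|nzH] := eqVneq H 0%VS.
  by exists 1%N; rewrite /= H0 liev_sym liev0.
have [|M [[sM sMH neMH] _ maxM]] := @maximal_above _ _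
    (fun V => [/\ lie_subalg V, (V <= H)%VS & V != H]) 0%VS.
  by rewrite /lie_subalg liev0 !sub0v eq_sym.
have [|x Mx|k Mk] := IHn M _ sM; [|exact/nilH/(subvP sMH)|].
  apply: leq_trans leHn; rewrite ltn_neqAle dimvS // andbT.
  by apply: contra neMH => /eqP e; rewrite eqEdim sMH e leqnn.
pose W j := iter j (liev M) H.
have sWH j : (W j <= H)%VS by apply: iter_liev_sub; apply: subv_trans (lievS sMH _) sH.
(* An element outside M of the last iterate of H under ad M not inside M
   normalises M. *)
have [h [Hh nMh sMh]] : exists h, [/\ h \in H, h \notin M & (liev M <[h]> <= M)%VS].
  have exW : exists j, (W j <= M)%VS.
    by exists k; rewrite (subv_trans (iter_lievS _ _ (subvf H))) // Mk sub0v.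
  case: (ex_minnP exW) => [[|j] sWj minj].
    by case/negP: neMH; rewrite eqEsubv sMH.
  have /subvPn[h Wh nMh] : ~~ (W j <= M)%VS by apply/negP => /minj; rewrite ltnn.
  exists h; split=> //; first exact: subvP (sWH j) _ Wh.
  by apply: subv_trans sWj; apply: lievS.
have defH : (M + <[h]>)%VS = H.
  apply/eqP/negPn/negP => neH; have : (M + <[h]>)%VS = M.
    apply: maxM (addvSl _ _); split=> //; last by rewrite subv_add sMH -memvE.
    apply: subv_trans (lievDl _ _ _) _; rewrite subv_add; apply/andP; split.
      apply: subv_trans (lievDr _ _ _) _; apply: subv_trans (addvSl _ _).
      by rewrite subv_add sMh andbT.
    apply: subv_trans (lievDr _ _ _) _; rewrite subv_add [liev <[h]> M]liev_sym.
    rewrite (subv_trans sMh) ?addvSl //=.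
    apply: subv_trans (liev_line _ _) _; rewrite limg_line lfunE /= liexx.
    exact: sub0v.
  by move=> e; case/negP: nMh; rewrite -e (subvP (addvSr _ _)) ?memv_line.
pose U j := iter j (liev M) {:L}%VS.
have hU j : (liev <[h]> (U j) <= U j)%VS.
  elim: j => [|j IHj]; first exact: subvf.
  apply: subv_trans (liev_leibniz _ _ _) _; rewrite subv_add.
  by rewrite !lievS // liev_sym.
have sU j : (U j.+1 <= U j)%VS.
  by elim: j => [|j IHj]; [apply: subvf | apply: lievS].
have [p hp] := nilH h Hh.
suff: forall j, exists m, (iter m (liev H) {:L}%VS <= U j)%VS.
  by move=> /(_ k)[m]; rewrite /U Mk subv0 => /eqP; exists m.
elim=> [|j [m IHm]]; first by exists 0%N; apply: subvf.
exists (p + m)%N; rewrite iterD; apply: subv_trans (iter_lievS _ _ IHm) _.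
pose X q := iter q (liev <[h]>) (U j).
have sX q : (X q <= U j)%VS by apply: iter_liev_sub.
have X0 : X p = 0%VS.
  apply/eqP; rewrite -subv0; apply/subvP => w /iter_liev_line[u _ ->].
  by rewrite hp mem0v.
rewrite -[U j.+1]add0v -X0; elim: (p) => [|q IHq]; first exact: addvSl.
apply: subv_trans (lievS (subvv H) IHq) _; rewrite -{1}defH.
apply: subv_trans (lievDl _ _ _) _; rewrite subv_add; apply/andP; split.
  apply: subv_trans (addvSr _ _); apply: lievS (subvv M) _.
  by rewrite subv_add sX sU.
apply: subv_trans (lievDr _ _ _) _; apply: addvS; first exact: subvv.
exact: hU.
Qed.

Lemma ad_nilpotent_nilpotent H : lie_subalg H -> {in H, forall x, ad_nilpotent x} ->
  nilpotent H.
Proof.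
move=> sH nilH; have [k Hk] := engel sH nilH; exists k.
by rewrite -subv0 -Hk iter_lievS ?subvf.
Qed.

Lemma ad_nilpotent_perfect H : {in H, forall x, ad_nilpotent x} -> liev H H = H ->
  H = 0%VS.
Proof.
move=> nilH eH; have [|k Hk] := engel _ nilH; first by rewrite /lie_subalg eH subvv.
apply/eqP; rewrite -subv0 -Hk; elim: k {Hk} => [|k IHk]; first exact: subvf.
by rewrite -{1}eH lievS.
Qed.

End Engel.

(** * The Killing form, nilpotency and Cartan's criterion *)

Section Killing.
Variables (C : numClosedFieldType) (L : lieAlgType C).
Implicit Types (U V W I J M N A B H : {vspace L}) (x y z u v w : L).

(** ad x, as an endomorphism. *)
Definition adl x : 'End(L) := linfun (lie x).

Lemma adlE x y : adl x y = lie x y.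
Proof. exact: lfunE. Qed.

Lemma adl_linear a x y : adl (a *: x + y) = a *: adl x + adl y.
Proof.
apply/lfunP => v; rewrite add_lfunE scale_lfunE !adlE.
by rewrite -/(lier v _) linearP.
Qed.

Lemma lie_lie x y v : lie (lie x y) v = lie x (lie y v) - lie y (lie x v).
Proof.
have /eqP := lie_jacobi x y v; rewrite addr_eq0 => /eqP.
rewrite [lie v (lie x y)]lieC opprK => <-; congr (_ + _).
by rewrite (lieC v x) linearN.
Qed.

Lemma lie_derivation x y v : lie x (lie y v) = lie (lie x y) v + lie y (lie x v).
Proof. by rewrite lie_lie subrK. Qed.

Lemma adl_lie x y : adl (lie x y) = (adl x \o adl y)%VF - (adl y \o adl x)%VF.
Proof.
by apply/lfunP => v; rewrite add_lfunE opp_lfunE !comp_lfunE !adlE lie_lie.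
Qed.

(** The Killing form. *)
Definition killing x y : C := lfun_tr (adl x \o adl y)%VF.

Lemma killingC x y : killing x y = killing y x.
Proof. exact: lfun_trC. Qed.

Lemma killingPl a x y z : killing (a *: x + y) z = a * killing x z + killing y z.
Proof. by rewrite /killing adl_linear comp_lfunDl -comp_lfunZl lfun_trP. Qed.

Lemma killing_is_scalar x : scalar (killing x).
Proof. by move=> a y z; rewrite killingC killingPl ![killing x _]killingC. Qed.
HB.instance Definition _ x :=
  GRing.isLinear.Build C L C *%R (killing x) (killing_is_scalar x).

(** tr ([f, g] h) = tr (f [g, h]) *)
Lemma lfun_tr_assoc (f g h : 'End(L)) :
  lfun_tr (((f \o g) - (g \o f)) \o h)%VF = lfun_tr (f \o ((g \o h) - (h \o g)))%VF.
Proof.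
rewrite comp_lfunDl comp_lfunDr comp_lfunNl comp_lfunNr !lfun_trB.
by rewrite -!comp_lfunA [lfun_tr (g \o _)%VF]lfun_trC -comp_lfunA.
Qed.

Lemma killing_assoc x y z : killing (lie x y) z = killing x (lie y z).
Proof. by rewrite /killing !adl_lie lfun_tr_assoc. Qed.

(** D is a derivation of L. *)
Definition derivation (D : 'End(L)) :=
  forall x y, D (lie x y) = lie (D x) y + lie x (D y).

Lemma derivation_adl D x : derivation D ->
  (D \o adl x)%VF - (adl x \o D)%VF = adl (D x).
Proof.
move=> derD; apply/lfunP => v; rewrite add_lfunE opp_lfunE !comp_lfunE !adlE.
by rewrite derD addrK.
Qed.

Lemma adl_is_derivation x : derivation (adl x).
Proof. by move=> y z; rewrite !adlE lie_derivation. Qed.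

Lemma pactXsubC (f : 'End(L)) a v : pact f ('X - a%:P) v = f v - a *: v.
Proof. by rewrite pactB pactX pactC. Qed.

(** For a derivation f, the bracket adds generalized eigenvalues. *)
Lemma geigen_lie (f : 'End(L)) a b v w : derivation f ->
  geigen f a v -> geigen f b w -> geigen f (a + b) (lie v w).
Proof.
move=> derf [k vk] [l wl]; exists (k + l)%N.
have [n] := ubnP (k + l); elim: n k l v w vk wl => // n IHn k l v w vk wl.
rewrite ltnS => lekl.
case: k vk lekl => [|k] vk lekl.
  by move: vk; rewrite expr0 pact1 => ->; rewrite -/(lier w 0) !linear0.
case: l wl lekl => [|l] wl lekl.
  by move: wl; rewrite expr0 pact1 => ->; rewrite !linear0.
rewrite addSn exprSr pactM.
have -> : pact f ('X - (a + b)%:P) (lie v w) =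
    lie (pact f ('X - a%:P) v) w + lie v (pact f ('X - b%:P) w).
  rewrite !pactXsubC derf -/(lier w (_ - _)) !linearB !linearZ /lier /=.
  by rewrite scalerDl addrACA.
rewrite linearD /= IHn ?add0r; first last.
- by rewrite addSn in lekl.
- by [].
- by rewrite -pactM -exprSr.
by rewrite addnS -addSn IHn // -?pactM -?exprSr // -ltnS -addnS.
Qed.

Lemma geigen_derivation (f D : 'End(L)) (u : C -> C) : derivation f ->
    (forall a b, u (a + b) = u a + u b) ->
    (forall a v, geigen f a v -> D v = u a *: v) ->
  derivation D.
Proof.
move=> derf uD Du v w; move: v; apply: (@geigen_ind _ _ f) => [|v1 v2 E1 E2|a v av].
- by rewrite linear0 !lie0l linear0 addr0.
- by rewrite !(lieDl, linearD) /= E1 E2 addrACA.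
move: w; apply: (@geigen_ind _ _ f) => [|w1 w2 E1 E2|b w bw].
- by rewrite !linear0 addr0.
- by rewrite !(lieDr, linearD) /= E1 E2 addrACA.
rewrite (Du _ _ (geigen_lie derf av bw)) (Du _ _ av) (Du _ _ bw) uD scalerDl.
by rewrite lieZl lieZr.
Qed.

Lemma geigen_automorphism (f D : 'End(L)) (u : C -> C) : derivation f ->
    (forall a b, u (a + b) = u a * u b) ->
    (forall a v, geigen f a v -> D v = u a *: v) ->
  forall v w, D (lie v w) = lie (D v) (D w).
Proof.
move=> derf uD Du v w; move: v; apply: (@geigen_ind _ _ f) => [|v1 v2 E1 E2|a v av].
- by rewrite linear0 !lie0l linear0.
- by rewrite !(lieDl, linearD) /= E1 E2.
move: w; apply: (@geigen_ind _ _ f) => [|w1 w2 E1 E2|b w bw].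
- by rewrite !linear0.
- by rewrite !(lieDr, linearD) /= E1 E2.
rewrite (Du _ _ (geigen_lie derf av bw)) (Du _ _ av) (Du _ _ bw) uD.
by rewrite lieZl lieZr scalerA.
Qed.

(** The criterion behind both nilpotency results below. Let D act as the
    conjugate of a on the generalized eigenspace of ad x for a: it is a
    derivation, and D V is inside [x, [x, V]], so that tr (ad x D), which is the
    sum of the |a|^2, reduces to values of the Killing form on A and [x, [x, V]]. *)
Lemma ad_nilpotent_killing A V x :
    {in V, forall v, lie x v \in V} -> x \in liev A V ->
    {in A & V, forall a v, killing a (lie x (lie x v)) = 0} ->
  ad_nilpotent x.
Proof.
move=> xV AVx kAV.
have [D [DE D2 Dnil]] := spectral_calculus (adl x) (fun a => a^* : C).
have derD : derivation D.
  by apply: (geigen_derivation (adl_is_derivation x) _ DE) => a b; apply: rmorphD.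
have {}D2 : {in V, forall v, exists2 w, w \in V & D v = lie x (lie x w)}.
  move=> v Vv; have [| |w Vw ->] := D2 _ V _ v Vv; first exact: rmorph0.
    by move=> w Vw; rewrite adlE xV.
  by exists w; rewrite ?adlE.
suff tr0 : lfun_tr (adl x \o D)%VF = 0.
  have [//|k nil] := Dnil _ tr0; exists k => v; rewrite -[RHS](nil v).
  by apply: eq_iter => w; rewrite adlE.
move: AVx; pose P y := lfun_tr (adl y \o D)%VF = 0; rewrite -[_ = _]/(P x).
apply: liev_ind => [|c y z Py Pz|a v Aa Vv]; rewrite /P.
- have -> : adl 0 = 0 by apply/lfunP => v; rewrite adlE lie0l zero_lfunE.
  by rewrite comp_lfun0l lfun_tr0.
- by rewrite adl_linear comp_lfunDl -comp_lfunZl lfun_trP Py Pz mulr0 addr0.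
rewrite adl_lie lfun_tr_assoc -[_ - _]opprB derivation_adl // comp_lfunNr lfun_trN.
by have [w Vw ->] := D2 v Vv; rewrite -/(killing _ _) kAV ?oppr0.
Qed.

(** The iterated brackets [H, [H, ..., L]] form a decreasing chain of ideals down
    to 0, along which ad u ad x moves one step for x in H. *)
Lemma killing_nilpotent_ideal H : lie_ideal fullv H ->
  {in H, forall x, ad_nilpotent x} -> forall u x, x \in H -> killing u x = 0.
Proof.
move=> iH nilH u x Hx; have [k Hk] := engel (lie_ideal_subalg iH) nilH.
have iU j : lie_ideal fullv (iter j (liev H) {:L}%VS).
  elim: j => [|j IHj]; last exact: ideal_liev.
  exact: lie_ideal_refl (lie_subalgf _).
apply: (lfun_tr_nilpotent (k := k)) => v; apply/eqP; rewrite -memv0 -Hk.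
elim: k {Hk} => [|k IHk]; first exact: memvf.
rewrite iterS comp_lfunE !adlE; have /andP[_ iS] := iU k.+1.
by apply: (subvP iS); rewrite memv_lie ?memvf // memv_lie.
Qed.

(** By induction on the derived length of I: for x in [L, I], the space
    [x, [x, I]] is inside [L, [I, I]], which is orthogonal to L by induction. *)
Lemma ad_nilpotent_solvable_ideal I : lie_ideal fullv I -> solvable I ->
  {in liev fullv I, forall x, ad_nilpotent x}.
Proof.
move=> iI [n In]; elim: n I iI In => [|n IHn] I iI In x LIx.
  have I0 : I = 0%VS := eqP In.
  by move: LIx; rewrite I0 liev0 memv0 => /eqP ->; exists 1%N => v; rewrite /= lie0l.
have iII := ideal_liev iI iI.
have iLII := ideal_liev (lie_ideal_refl (lie_subalgf _)) iII.
have {}IHn : {in liev fullv (liev I I), forall y, ad_nilpotent y}.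
  by apply: IHn => //; rewrite /derived -iterSr.
have Ix : x \in I by case/andP: iI => _ /subvP/(_ x LIx).
have xI : {in I, forall v, lie x v \in I}.
  by move=> v Iv; case/andP: iI => _ /subvP; apply; rewrite memv_lie ?memvf.
apply: (ad_nilpotent_killing xI LIx) => a v _ Iv.
apply: (killing_nilpotent_ideal iLII IHn).
by rewrite memv_lie ?memvf // memv_lie.
Qed.

(** Cartan's criterion. The derived series of A stops at a perfect algebra, whose
    elements are ad-nilpotent, so that it vanishes by Engel's theorem. *)
Lemma cartan_solvable A : lie_subalg A -> {in A &, forall x y, killing x y = 0} ->
  solvable A.
Proof.
move=> sA kA; have [n /eqP eqn] : exists n, derived n.+1 A == derived n A.
  have [n en] := iter_stable (f := fun V => V :&: liev V V)%VS (fun V => capvSl _ _) A.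
  suff e j : iter j (fun V => V :&: liev V V)%VS A = derived j A.
    by exists n; rewrite -!e.
  elim: j => //= j ->; apply/capv_idPr; exact: derived_subalg.
exists n; apply/eqP; have sAn := derived_sub n sA.
apply: ad_nilpotent_perfect (eqn) => x Anx.
have xAn : {in derived n A, forall v, lie x v \in derived n A}.
  by move=> v Av; rewrite -eqn memv_lie.
apply: (ad_nilpotent_killing xAn (A := derived n A)).
  by have : x \in derived n.+1 A by rewrite eqn.
by move=> a v Aa Av; rewrite kA ?(subvP sAn) // xAn ?xAn.
Qed.

End Killing.

(** * Quotient Lie algebras *)

Section Quotient.
Variables (K : fieldType) (L : lieAlgType K) (I : {vspace L}).

(** The quotient Lie algebra L / I, carried by a complement of I. *)
Definition lie_quo (iI : lie_ideal fullv I) : Type := subvs_of (I^C)%VS.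

Variable iI : lie_ideal fullv I.
Local Notation Q := (lie_quo iI).
HB.instance Definition _ := Vector.copy Q (subvs_of (I^C)%VS).

(** The projection of L onto L / I. *)
Definition quo_proj (x : L) : Q := vsproj (I^C)%VS (x - projv I x).
(** The representative in the chosen complement of I. *)
Definition quo_repr (q : Q) : L := vsval q.

Lemma quo_proj_is_linear : linear quo_proj.
Proof.
move=> a x y; rewrite /quo_proj linearP opprD addrACA -scalerBr.
exact: (linearP (vsproj (I^C)%VS)).
Qed.
HB.instance Definition _ := GRing.isLinear.Build K L Q *:%R quo_proj quo_proj_is_linear.

Lemma quo_repr_is_linear : linear quo_repr.
Proof. by []. Qed.
HB.instance Definition _ := GRing.isLinear.Build K Q L *:%R quo_repr quo_repr_is_linear.

Lemma quo_projE x : quo_repr (quo_proj x) = x - projv I x.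
Proof. exact/vsprojK/memv_projC. Qed.

Lemma quo_proj_eq0 x : (quo_proj x == 0) = (x \in I).
Proof.
apply/eqP/idP => [/(congr1 quo_repr)|Ix].
  by rewrite quo_projE linear0 => /eqP; rewrite subr_eq0 => /eqP ->; apply: memv_proj.
by rewrite /quo_proj projv_id // subrr; exact: (linear0 (vsproj (I^C)%VS)).
Qed.

Lemma quo_reprK : cancel quo_repr quo_proj.
Proof.
move=> q; rewrite /quo_proj; have -> : projv I (quo_repr q) = 0.
  by apply/eqP; rewrite -memv_ker lker_proj; apply: subvsP.
rewrite subr0; exact: vsvalK.
Qed.

(** The bracket of L / I, computed on representatives. *)
Definition quo_lie (p q : Q) : Q := quo_proj (lie (quo_repr p) (quo_repr q)).

Lemma quo_proj_lie x y : quo_proj (lie x y) = quo_lie (quo_proj x) (quo_proj y).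
Proof.
apply/eqP; rewrite -subr_eq0 /quo_lie -linearB quo_proj_eq0 /= !quo_projE.
set u := projv I x; set v := projv I y.
have /andP[_ sI] := iI; have [Iu Iv] : u \in I /\ v \in I by rewrite !memv_proj.
rewrite lieBl [lie x (y - v)]lieBr !opprB addrCA [lie x y + _]addrCA subrr addr0.
by rewrite memvD // ?[lie u _]lieC ?memvN (subvP sI) ?memv_lie ?memvf.
Qed.

Lemma quo_lie_linearl q : linear (quo_lie^~ q).
Proof. by move=> a p r; rewrite /quo_lie linearP lieDl lieZl linearP. Qed.

Lemma quo_lie_linearr p : linear (quo_lie p).
Proof. by move=> a q r; rewrite /quo_lie !linearP. Qed.

Lemma quo_liexx q : quo_lie q q = 0.
Proof. by rewrite /quo_lie liexx linear0. Qed.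

Lemma quo_lie_jacobi x y z :
  quo_lie x (quo_lie y z) + quo_lie y (quo_lie z x) + quo_lie z (quo_lie x y) = 0.
Proof.
rewrite -(quo_reprK x) -(quo_reprK y) -(quo_reprK z) -!quo_proj_lie -!linearD.
by rewrite lie_jacobi linear0.
Qed.

HB.instance Definition _ := Vector_isLieAlgebra.Build K Q
  quo_lie_linearl quo_lie_linearr quo_liexx quo_lie_jacobi.

Lemma quo_projM x y : quo_proj (lie x y) = lie (quo_proj x) (quo_proj y).
Proof. exact: quo_proj_lie. Qed.

End Quotient.

Section QuotientIdeals.
Variables (K : fieldType) (L : lieAlgType K) (I : {vspace L}).
Variable iI : lie_ideal fullv I.
Local Notation Q := (lie_quo iI).
Local Notation pi := (linfun (@quo_proj K L I iI)).

Lemma quo_projP (q : Q) : exists x : L, pi x = q.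
Proof. by exists (quo_repr q); rewrite lfunE /= quo_reprK. Qed.

Lemma quo_proj_bracket x y : pi (lie x y) = lie (pi x) (pi y).
Proof. by rewrite !lfunE /= quo_projM. Qed.

Lemma preim_lie_ideal (J : {vspace Q}) :
  lie_ideal fullv J -> lie_ideal fullv (pi @^-1: J)%VS.
Proof.
case/andP=> _ iJ; rewrite /lie_ideal subvf /=; apply/lievP => x y _.
rewrite -!memv_preim quo_proj_bracket => Jy.
by rewrite (subvP iJ) // memv_lie ?memvf.
Qed.

Lemma img_lie_ideal (J : {vspace L}) :
  lie_ideal fullv J -> lie_ideal fullv (pi @: J)%VS.
Proof.
case/andP=> _ iJ; rewrite /lie_ideal subvf /=; apply/lievP => q _ _ /memv_imgP[y Jy ->].
have [x <-] := quo_projP q; rewrite -quo_proj_bracket memv_img //.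
by rewrite (subvP iJ) // memv_lie ?memvf.
Qed.

Lemma sub_preim (J : {vspace Q}) : (I <= pi @^-1: J)%VS.
Proof.
apply/subvP => x Ix; rewrite -memv_preim lfunE /=.
by have /eqP -> : quo_proj iI x == 0; rewrite ?quo_proj_eq0 // mem0v.
Qed.

Lemma img_preim (J : {vspace Q}) : (pi @: (pi @^-1: J))%VS = J.
Proof.
apply: lpreimK; apply/subvP => q _; have [x <-] := quo_projP q.
exact/memv_img/memvf.
Qed.

Lemma preim_maximal_ideal (M : {vspace Q}) :
  maximal_ideal fullv M -> maximal_ideal fullv (pi @^-1: M)%VS.
Proof.
case=> iM neM maxM; split.
- exact: preim_lie_ideal.
- apply: contraNneq neM => e; rewrite -(img_preim M) e eqEsubv subvf.
  by apply/subvP => q _; have [x <-] := quo_projP q; apply/memv_img/memvf.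
move=> V iV sMV; have eV : (pi @^-1: (pi @: V))%VS = V.
  apply: subv_anti; apply/andP; split; apply/subvP => x; rewrite -memv_preim.
    case/memv_imgP => y Vy /eqP; rewrite -subr_eq0 -linearB /= lfunE /= quo_proj_eq0.
    move=> Ixy; rewrite -(subrK y x) memvD //.
    by rewrite (subvP sMV) // (subvP (sub_preim M)).
  exact: memv_img.
have [||e|e] := maxM (pi @: V)%VS; first exact: img_lie_ideal.
- by rewrite -(img_preim M) limgS.
- by left; rewrite -eV e.
right; apply: subv_anti; rewrite subvf -eV e.
by apply/subvP => x _; rewrite -memv_preim memvf.
Qed.

Lemma derived_preim n (J : {vspace Q}) :
  (derived n (pi @^-1: J) <= pi @^-1: (derived n J))%VS.
Proof.
elim: n => [|n IHn]; first exact: subvv.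
apply/lievP => x y /(subvP IHn); rewrite -!memv_preim => Jx.
move=> /(subvP IHn); rewrite -memv_preim => Jy.
by rewrite quo_proj_bracket memv_lie.
Qed.

Lemma preim_solvable (J : {vspace Q}) : solvable I -> solvable J ->
  solvable (pi @^-1: J)%VS.
Proof.
move=> [m /eqP Im] [n /eqP Jn]; exists (m + n)%N.
rewrite /derived iterD -!/(derived _ _) -subv0 -Im; apply: derivedS.
apply: subv_trans (derived_preim n J) _; rewrite Jn lpreim0.
by apply/subvP => x; rewrite memv_ker lfunE /= quo_proj_eq0.
Qed.
End QuotientIdeals.

(** * Algebras whose solvable ideals are central *)

Section Reductive.
Variables (C : numClosedFieldType) (L : lieAlgType C).
Implicit Types (U V W I J M N A B H : {vspace L}) (x y z u v w : L).

(** Functionals on J are represented by the Killing form as soon as they vanish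
    on the radical of its restriction to J. *)
Lemma killing_riesz J (phi : {scalar L}) :
    {in J, forall z, {in J, forall y, killing z y = 0} -> phi z = 0} ->
  exists2 j, j \in J & {in J, forall y, killing j y = phi y}.
Proof.
move=> phiJ; pose X := vbasis J.
have JX k : X`_k \in J.
  have [lt|ge] := ltnP k (size X); first exact/vbasis_mem/mem_nth.
  by rewrite nth_default ?mem0v.
pose G := \matrix_(i < \dim J, k < \dim J) killing X`_i X`_k.
pose r := \row_(k < \dim J) phi X`_k.
have /submxP[c def_r] : (r <= G)%MS.
  rewrite submxE; apply/eqP/rowP => l; rewrite [RHS]mxE.
  pose z := \sum_k cokermx G k l *: X`_k.
  have -> : (r *m cokermx G) 0 l = phi z.
    rewrite mxE linear_sum; apply: eq_bigr => k _.
    by rewrite mxE linearZ /= mulrC.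
  apply: phiJ => [|y /coord_vbasis ->].
    by apply: memv_suml => k _; rewrite memvZ.
  rewrite linear_sum big1 // => i _; rewrite linearZ /=.
  suff -> : killing z X`_i = (G *m cokermx G) i l by rewrite mulmx_coker mxE mulr0.
  rewrite killingC linear_sum mxE; apply: eq_bigr => k _.
  by rewrite linearZ /= mulrC [G i k]mxE.
exists (\sum_i c 0 i *: X`_i) => [|y /coord_vbasis ->].
  by apply: memv_suml => i _; rewrite memvZ.
rewrite !linear_sum; apply: eq_bigr => k _; rewrite !linearZ /=; congr (_ * _).
have := congr1 (fun m : 'rV_(\dim J) => m 0 k) def_r; rewrite !mxE => ->.
rewrite killingC linear_sum; apply: eq_bigr => i _.
by rewrite linearZ /= mxE killingC.
Qed.

Lemma scalar_pack (phi : L -> C) : scalar phi -> {psi : {scalar L} | psi =1 phi}.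
Proof.
move=> lphi.
pose psi : {scalar L} := HB.pack phi (GRing.isLinear.Build C L C *%R phi lphi).
by exists psi.
Qed.

Lemma killingNl x y : killing (- x) y = - killing x y.
Proof. by rewrite killingC linearN /= killingC. Qed.

Lemma killingBl x y z : killing (x - y) z = killing x z - killing y z.
Proof. by rewrite killingC linearB /= ![killing z _]killingC. Qed.

(** The orthogonal of J for the Killing form. *)
Lemma killing_orth_ex J : exists W, forall x,
  (x \in W) <-> {in J, forall y, killing x y = 0}.
Proof.
have [W WP] := @vbigcap_ex _ _ {:L}%VS (fun V => exists2 y, y \in J &
  forall x, x \in V <-> killing x y = 0).
exists W => x; rewrite WP; split=> [[_ Wx] y Jy|Jx]; last first.
  by split=> [|V [y /Jx kxy ->]]; rewrite ?memvf.
pose ky : L -> C^o := killing y.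
have kyl : linear ky by move=> a u v; rewrite /ky (linearP (killing y)).
pose f : {linear L -> C^o} := HB.pack ky (GRing.isLinear.Build C L C^o *:%R ky kyl).
suff /Wx : exists2 y, y \in J & forall v, v \in lker (linfun f) <-> killing v y = 0.
  by rewrite memv_ker lfunE /= /ky killingC => /eqP.
exists y => // v; rewrite memv_ker lfunE /= /ky killingC; split=> /eqP //.
Qed.

Lemma killing_orth_ideal J W : lie_ideal fullv J ->
    (forall x, (x \in W) <-> {in J, forall y, killing x y = 0}) ->
  lie_ideal fullv W.
Proof.
case/andP=> _ iJ WP; rewrite /lie_ideal subvf /=; apply/lievP => x w _ /WP kwJ.
apply/WP => y Jy; rewrite lieC killingC linearN /= killingC killing_assoc kwJ ?oppr0 //.
by rewrite (subvP iJ) // memv_lie ?memvf.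
Qed.

Lemma jacobson_ideal : lie_ideal fullv (jacobson {:L}%VS).
Proof.
rewrite /lie_ideal subvf /=; apply/lievP => x y _ /memv_bigcap[_ Jy].
apply/memv_bigcap; split=> [|M mM]; first exact: memvf.
by have [/andP[_ /subvP iM] _ _] := mM; rewrite iM // memv_lie ?memvf ?Jy.
Qed.

Lemma adl_central z : (forall x, lie x z = 0) -> adl z = 0.
Proof. by move=> cz; apply/lfunP => v; rewrite adlE lieC cz oppr0 zero_lfunE. Qed.

Lemma killing_central z y : (forall x, lie x z = 0) -> killing z y = 0.
Proof. by move=> /adl_central cz; rewrite /killing cz comp_lfun0l lfun_tr0. Qed.

(** L is reductive: its solvable ideals are central. *)
Hypothesis reductiveL :
  forall A, lie_ideal fullv A -> solvable A -> liev fullv A = 0%VS.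

Lemma isotropic_central A : lie_ideal fullv A ->
    {in A &, forall x y, killing x y = 0} ->
  {in A, forall z x, lie x z = 0}.
Proof.
move=> iA kA z Az x; apply/eqP; rewrite -memv0.
by rewrite -(reductiveL iA (cartan_solvable (lie_ideal_subalg iA) kA)) memv_lie ?memvf.
Qed.

Lemma killing_radical_central z : (forall y, killing z y = 0) -> forall x, lie x z = 0.
Proof.
move=> kz; have [W WP] := killing_orth_ex {:L}%VS.
have iW := killing_orth_ideal (lie_ideal_refl (lie_subalgf _)) WP.
apply: (isotropic_central iW) => [x y /WP kx _|]; first by rewrite kx ?memvf.
by apply/WP => y _.
Qed.

(** The centre meets [L, L] trivially. Given a functional lam, lam [x, y] is
    kappa (D0 x, y) for some D0, and tr (D0 ad x) is kappa (d, x) for some d. Up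
    to central terms D0 is a derivation, whence E = D0 - ad d has central values,
    and lam and kappa (d, _) agree on [L, L]. *)
Lemma reductive_derived_central z :
  z \in liev {:L} {:L} -> (forall x, lie x z = 0) -> z = 0.
Proof.
move=> Lz cz; suff lam0 (lam : {scalar L}) : lam z = 0.
  by rewrite (coord_vbasis (memvf z)) big1 // => i _; rewrite lam0 scale0r.
have /choice[d0 d0P] x : exists d, forall y, killing d y = lam (lie x y).
  have [|d _ dP] := @killing_riesz {:L}%VS (lam \o lie x).
    move=> z' _ kz'; rewrite /= killing_radical_central ?linear0 // => y.
    by rewrite kz' ?memvf.
  by exists d => y; rewrite dP ?memvf.
have [D0 D0P] : exists D : 'End(L), forall x y, killing (D x) y = lam (lie x y).
  pose X := vbasis {:L}.
  have [f /(_ (basis_free (vbasisP _)))] := linear_of_free X (map d0 X).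
  rewrite size_map => /(_ erefl) fX; exists (linfun f) => x y.
  have fXi (i : 'I_(\dim {:L})) : f X`_i = d0 X`_i.
    have lti : (i < size X)%N by rewrite size_tuple.
    by rewrite -(nth_map 0 0) // fX (nth_map 0).
  rewrite lfunE /= (coord_vbasis (memvf x)) linear_sum killingC linear_sum.
  rewrite -/(lier y _) !linear_sum; apply: eq_bigr => i _.
  by rewrite !linearZ /= fXi killingC d0P.
have [|psi psiE] := @scalar_pack (fun x => lfun_tr (D0 \o adl x)%VF).
  by move=> a x y; rewrite adl_linear comp_lfunDr -comp_lfunZr lfun_trP.
have [|d _ dP] := @killing_riesz {:L}%VS psi.
  move=> z' _ kz'; rewrite psiE adl_central ?comp_lfun0r ?lfun_tr0 //.
  by apply: killing_radical_central => y; rewrite kz' ?memvf.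
have {dP}dP x : killing d x = lfun_tr (D0 \o adl x)%VF by rewrite dP ?psiE ?memvf.
pose E := D0 - adl d.
have trE x : lfun_tr (E \o adl x)%VF = 0.
  by rewrite /E comp_lfunDl comp_lfunNl lfun_trB -dP subrr.
pose P x : 'End(L) := (E \o adl x)%VF - (adl x \o E)%VF - adl (E x).
have cP x v y : lie y (P x v) = 0.
  apply: killing_radical_central => w.
  have -> : P x v = D0 (lie x v) - lie x (D0 v) - lie (D0 x) v.
    rewrite /P /E !(add_lfunE, opp_lfunE, comp_lfunE, adlE).
    rewrite lieBr lieBl (lie_derivation d) opprD !opprB !addrA subrK.
    by rewrite [_ - _ + lie (lie d x) v]addrAC subrK.
  rewrite !killingBl [lie x (D0 v)]lieC killingNl !killing_assoc !D0P.
  rewrite -linearN -!linearB /=.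
  by rewrite lie_lie opprK subrK subrr linear0.
have kE x y : killing (E x) y = 0.
  have -> : killing (E x) y =
      lfun_tr (((E \o adl x) - (adl x \o E)) \o adl y)%VF - lfun_tr (P x \o adl y)%VF.
    have -> : (E \o adl x)%VF - (adl x \o E)%VF = P x + adl (E x) by rewrite subrK.
    by rewrite comp_lfunDl lfun_trD addrAC subrr add0r.
  rewrite lfun_tr_assoc -adl_lie trE lfun_trC.
  suff -> : (adl y \o P x)%VF = 0 by rewrite lfun_tr0 subrr.
  by apply/lfunP => v; rewrite comp_lfunE adlE cP zero_lfunE.
suff -> : lam z = killing d z by rewrite killingC killing_central.
move: z Lz {cz}; apply: liev_ind => [|a x y|x y _ _]; first by rewrite !linear0.
  by rewrite !linearP => -> ->.
rewrite -D0P -killing_assoc; apply/eqP; rewrite -subr_eq0 -killingBl.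
by apply/eqP; rewrite -[RHS](kE x y) /E add_lfunE opp_lfunE adlE.
Qed.

Lemma reductive_jacobson : jacobson {:L}%VS = 0%VS.
Proof.
set J := jacobson _; have iJ : lie_ideal fullv J := jacobson_ideal.
have [W WP] := killing_orth_ex J; have iW := killing_orth_ideal iJ WP.
have iJW : lie_ideal fullv (J :&: W)%VS.
  have [[_ sJ] [_ sW]] := (andP iJ, andP iW).
  rewrite /lie_ideal subvf subv_cap /=; apply/andP; split.
    by apply: subv_trans sJ; rewrite lievS // capvSl.
  by apply: subv_trans sW; rewrite lievS // capvSr.
have cJW : {in (J :&: W)%VS, forall z x, lie x z = 0}.
  apply: isotropic_central iJW _ => x y /memv_capP[_ /WP kx] /memv_capP[Jy _].
  exact: kx.
have LJW x : x \in (J + W)%VS.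
  have [|j Jj jP] := @killing_riesz J (killing x).
    move=> z Jz kz; rewrite /= killingC killing_central //; apply: cJW.
    by rewrite memv_cap Jz; apply/WP.
  rewrite -(subrK j x) addrC memv_add //; apply/WP => y Jy.
  by rewrite killingBl jP ?subrr.
have WL : W = {:L}%VS.
  apply/eqP/negPn/negP => neW.
  have [|M [[iM neM] sWM maxM]] := @maximal_above _ _
      (fun V => lie_ideal fullv V /\ V != {:L}%VS) W; first by [].
  case/negP: (neM); rewrite eqEsubv subvf; apply/subvP => x _.
  suff /subvP : (J + W <= M)%VS by apply.
  rewrite subv_add sWM andbT; apply/subvP => y /memv_bigcap[_]; apply.
  split=> // V iV sMV; have [->|neV] := eqVneq V {:L}%VS; first by right.
  by left; apply: maxM.
apply/eqP; rewrite -subv0; apply/subvP => x Jx; rewrite memv0; apply/eqP.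
apply: reductive_derived_central.
  by apply: subvP Jx; apply: jacobson_sub_derived; apply: lie_subalgf.
by apply: cJW; rewrite WL capvf.
Qed.

End Reductive.

(** * The Jacobson ideal is [L, rad L] *)

Section JacobsonIdeal.
Variables (C : numClosedFieldType) (L : lieAlgType C).
Implicit Types (U V W I J M N A B H : {vspace L}) (x y z u v w : L).

Lemma lie_rad_ideal : lie_ideal fullv (lie_rad L).
Proof. exact: ideal_liev (lie_ideal_refl (lie_subalgf _)) (radical_ideal L). Qed.

Lemma lie_rad_nilpotent : nilpotent (lie_rad L).
Proof.
apply: ad_nilpotent_nilpotent (lie_ideal_subalg lie_rad_ideal) _.
exact: ad_nilpotent_solvable_ideal (radical_ideal L) (radical_solvable L).
Qed.

Lemma lie_rad_sub_nilradical : (lie_rad L <= nilradical L)%VS.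
Proof. exact: nilradical_max lie_rad_ideal lie_rad_nilpotent. Qed.

(** A maximal ideal M not containing the radical has a solvable quotient, hence
    an abelian one. *)
Lemma lie_rad_sub_jacobson : (lie_rad L <= jacobson {:L})%VS.
Proof.
apply/subvP => x Kx; apply/memv_bigcap; split=> [|M [iM neM maxM]].
  exact: memvf.
have [sRM|nsRM] := boolP (radical L <= M)%VS.
  have [_ iR] := andP (radical_ideal L).
  by rewrite (subvP sRM) // (subvP iR).
have eMR : (M + radical L)%VS = {:L}%VS.
  have [||e|//] := maxM (M + radical L)%VS; rewrite ?addvSl //.
    exact: lie_idealD (radical_ideal L).
  by case/negP: nsRM; rewrite -e addvSr.
have iL := lie_ideal_refl (lie_subalgf L); have iLL := ideal_liev iL iL.
have [||e|e] := maxM (M + liev {:L} {:L})%VS; rewrite ?addvSl //.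
- exact: lie_idealD.
- rewrite -e (subvP (addvSr _ _)) //; apply: subvP Kx.
  exact: lievS (subvv _) (subvf _).
case/negP: neM; rewrite eqEsubv subvf /=.
have [n /eqP Rn] := radical_solvable L.
suff : ({:L} <= M + derived n {:L})%VS.
  move/subv_trans; apply; rewrite subv_add subvv -eMR /=.
  by apply: subv_trans (derived_addv n _ iM) _; rewrite Rn addv0.
elim: n {Rn} => [|n IHn]; first exact: addvSr.
rewrite -{1}e subv_add addvSl /=; apply: subv_trans (lievS IHn IHn) _.
exact: (derived_addv 1 _ iM).
Qed.

Lemma jacobson_sub_lie_rad : (jacobson {:L} <= lie_rad L)%VS.
Proof.
have redQ (A : {vspace lie_quo lie_rad_ideal}) : lie_ideal fullv A ->
    solvable A -> liev fullv A = 0%VS.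
  move=> iA solA; have /subvP sAR := radical_max (preim_lie_ideal iA)
    (preim_solvable (lie_rad_solvable L) solA).
  apply/eqP; rewrite -subv0; apply/lievP => p q _ Aq.
  have [[x <-] [y def_q]] := (quo_projP p, quo_projP q).
  rewrite -def_q -quo_proj_bracket memv0 lfunE /= quo_proj_eq0.
  by rewrite memv_lie ?memvf // sAR // -memv_preim def_q.
apply/subvP => x /memv_bigcap[_ Jx].
rewrite -(quo_proj_eq0 lie_rad_ideal) -memv0 -(reductive_jacobson redQ).
apply/memv_bigcap; split=> [|M /preim_maximal_ideal/Jx]; first exact: memvf.
by rewrite -memv_preim lfunE.
Qed.

Theorem jacobsonE : jacobson {:L}%VS = lie_rad L.
Proof. by apply: subv_anti; rewrite jacobson_sub_lie_rad lie_rad_sub_jacobson. Qed.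

(** If the Frattini subalgebra is an ideal, then a maximal ideal M not containing
    it lies in a maximal subalgebra containing both, which is absurd. *)
Lemma frattini_sub_jacobson : lie_ideal fullv (frattini {:L}%VS) ->
  (frattini {:L} <= jacobson {:L})%VS.
Proof.
move=> iF; apply/subvP => x Fx; apply/memv_bigcap; split=> [|M [iM neM maxM]].
  exact: memvf.
have [||e|e] := maxM (M + frattini {:L})%VS; rewrite ?addvSl //.
- exact: lie_idealD.
- by rewrite -e (subvP (addvSr _ _)).
have [|H [[sH neH] sMH maxH]] := @maximal_above _ _
    (fun V => lie_subalg V /\ V != {:L}%VS) M.
  by split=> //; apply: lie_ideal_subalg iM.
case/negP: (neH); rewrite eqEsubv subvf -e subv_add sMH.
apply/subvP => y /memv_bigcap[_]; apply; split; rewrite ?subvf // => V sV sHV _.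
have [->|neV] := eqVneq V {:L}%VS; first by right.
by left; apply: maxH.
Qed.

Lemma frattini_automorphism (f : 'End(L)) :
    (forall x y, f (lie x y) = lie (f x) (f y)) -> lker f = 0%VS ->
  {in frattini {:L}, forall x, f x \in frattini {:L}}.
Proof.
move=> fM /eqP kf x /memv_bigcap[_ Fx]; apply/memv_bigcap.
split=> [|M [sM _ neM maxM]]; first exact: memvf.
have lf := lker0_limgf kf.
have imgK V : (f @: (f @^-1: V))%VS = V by rewrite lpreimK // lf subvf.
have preK V : (f @^-1: (f @: V))%VS = V.
  apply: subv_anti; apply/andP; split; apply/subvP => y; rewrite -memv_preim.
    by case/memv_imgP => z Vz /(lker0P kf) ->.
  exact: memv_img.
rewrite memv_preim; apply: Fx; split; rewrite ?subvf //.
- apply/lievP => y z; rewrite -!memv_preim fM => My Mz.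
  by rewrite (subvP sM) // memv_lie.
- by apply: contraNneq neM => e; rewrite -(imgK M) e lf.
move=> V sV sMV _; have [|||e|e] := maxM (f @: V)%VS; rewrite ?subvf //.
- apply/lievP => _ _ /memv_imgP[y Vy ->] /memv_imgP[z Vz ->].
  by rewrite -fM memv_img // (subvP sV) // memv_lie.
- by rewrite -(imgK M) limgS.
- by left; rewrite -e preK.
- by right; rewrite -(preK V) e -{1}lf preK.
Qed.

End JacobsonIdeal.

(** * The exponential of a nilpotent derivation *)

Section ExpNilpotent.
Variables (C : numClosedFieldType) (L : lieAlgType C).
Variables (d : 'End(L)) (derd : derivation d) (m : nat).
Hypothesis dm0 : forall v, iter m d v = 0.
Implicit Types (v w : L) (t : C).

(** The divided powers d^k / k! of d. *)
Definition divpow k v : L := (k`!%:R)^-1 *: iter k d v.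

Lemma divpow_linear k : linear (divpow k).
Proof.
move=> a v w; rewrite /divpow; elim: k a v w => [|k IHk] a v w /=.
  by rewrite fact0 invr1 !scale1r.
have lin : iter k d (a *: v + w) = a *: iter k d v + iter k d w.
  have nz : k`!%:R != 0 :> C by rewrite pnatr_eq0 -lt0n fact_gt0.
  by apply: (scalerI (invr_neq0 nz)); rewrite IHk scalerDr !scalerA mulrC.
by rewrite lin linearP scalerDr !scalerA mulrC.
Qed.
HB.instance Definition _ k :=
  GRing.isLinear.Build C L L *:%R (divpow k) (divpow_linear k).

Lemma divpowS k v : d (divpow k v) = k.+1%:R *: divpow k.+1 v.
Proof.
rewrite /divpow linearZ scalerA /= factS natrM invfM mulrA divff ?mul1r //.
by rewrite pnatr_eq0.
Qed.

Lemma divpow_ge k v : (m <= k)%N -> divpow k v = 0.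
Proof.
move=> /subnK <-; rewrite /divpow iterD dm0.
suff -> : iter (k - m) d 0 = 0 by rewrite scaler0.
by elim: (k - m)%N => //= j ->; rewrite linear0.
Qed.

(** Leibniz's rule. *)
Lemma divpow_lie k v w :
  divpow k (lie v w) = \sum_(i < k.+1) lie (divpow i v) (divpow (k - i) w).
Proof.
elim: k => [|k IHk].
  by rewrite big_ord_recl big_ord0 addr0 /divpow /= fact0 invr1 !scale1r.
have nz : k.+1%:R != 0 :> C by rewrite pnatr_eq0.
apply: (scalerI nz); rewrite -divpowS IHk linear_sum scaler_sumr /=.
pose F i := lie (divpow i v) (divpow (k.+1 - i) w).
transitivity (\sum_(i < k.+1) (i.+1%:R *: F i.+1 + (k.+1 - i)%:R *: F i)).
  apply: eq_bigr => i _; rewrite derd !divpowS /F subSS lieZl lieZr subSn //.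
  by rewrite -ltnS.
rewrite big_split /=.
transitivity (\sum_(i < k.+2) (i%:R *: F i + (k.+1 - i)%:R *: F i)).
  rewrite big_split /=; congr (_ + _).
    by rewrite [RHS]big_ord_recl /= scale0r add0r.
  by rewrite [RHS]big_ord_recr /= subnn scale0r addr0.
by apply: eq_bigr => i _; rewrite -scalerDl -natrD subnKC // -ltnS.
Qed.

Lemma big_triangle (F : nat -> nat -> L) N :
  \sum_(k < N) \sum_(i < k.+1) F i (k - i)%N = \sum_(i < N) \sum_(j < N - i) F i j.
Proof.
elim: N => [|N IHN]; first by rewrite !big_ord0.
rewrite big_ord_recr IHN /= [RHS]big_ord_recr /= subSnn [X in _ = _ + X]big_ord_recl.
rewrite big_ord0 addr0 big_ord_recr /= subnn addrA -big_split /=; congr (_ + _).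
by apply: eq_bigr => i _; rewrite subSn ?big_ord_recr // ltnW.
Qed.

(** exp (t d), truncated at 2 m rather than m: the sum then contains all the
    nonzero terms of a product of two exponentials. *)
Definition exp_nil t v : L := \sum_(k < m + m) t ^+ k *: divpow k v.

Lemma exp_nil_linear t : linear (exp_nil t).
Proof.
move=> a v w; rewrite /exp_nil scaler_sumr -big_split; apply: eq_bigr => k _ /=.
rewrite divpow_linear; move: (divpow k v) (divpow k w) => v1 w1.
by rewrite scalerDr !scalerA mulrC.
Qed.
HB.instance Definition _ t :=
  GRing.isLinear.Build C L L *:%R (exp_nil t) (exp_nil_linear t).

Lemma exp_nil_lie t v w : exp_nil t (lie v w) = lie (exp_nil t v) (exp_nil t w).
Proof.
pose F i j := lie (t ^+ i *: divpow i v) (t ^+ j *: divpow j w).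
transitivity (\sum_(k < m + m) \sum_(i < k.+1) F i (k - i)%N).
  apply: eq_bigr => k _; rewrite divpow_lie scaler_sumr; apply: eq_bigr => i _.
  rewrite /F; move: (divpow i v) (divpow _ w) => v1 w1.
  by rewrite lieZl lieZr scalerA -exprD subnKC // -ltnS.
rewrite big_triangle /exp_nil lie_suml; apply: eq_bigr => i _; rewrite lie_sumr.
rewrite (big_ord_widen (m + m) (F i)) ?leq_subr //.
rewrite [RHS](bigID (fun j : 'I__ => (j < m + m - i)%N)) /=.
(* The terms with i + j >= 2 m vanish, as i >= m or j >= m. *)
rewrite [X in _ = _ + X]big1 ?addr0 // => j; rewrite -leqNgt leq_subLR => leij.
have [lemi|ltim] := leqP m i; first by rewrite divpow_ge // scaler0 lie0l.
rewrite [divpow j w]divpow_ge ?scaler0 ?lie0r //.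
by rewrite -(leq_add2l m) (leq_trans leij) // leq_add2r ltnW.
Qed.

Lemma exp_nil_pact t v :
  exp_nil t v = pact d (\sum_(k < m + m) (t ^+ k / k`!%:R) *: 'X^k) v.
Proof.
rewrite pact_sum; apply: eq_bigr => k _.
by rewrite pactZ pactXn /divpow scalerA.
Qed.

Lemma exp_nil_ker t v : exp_nil t v = 0 -> v = 0.
Proof.
have [m0|m_gt0] := posnP m; first by have := dm0 v; rewrite m0.
rewrite exp_nil_pact; set e := (X in pact d X v) => ev0.
apply: (@coprimep_pact0 _ _ d 'X^m e) => //; last by rewrite pactXn.
rewrite coprimep_expl // coprimep_sym coprimepX rootE /e horner_sum.
rewrite -(prednK m_gt0) addSn big_ord_recl hornerZ /= fact0 expr0 hornerC mulr1 divr1.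
rewrite big1 ?addr0 ?oner_eq0 // => k _.
by rewrite hornerZ hornerXn expr0n /= mulr0.
Qed.

(** A subspace stable under the one-parameter group of d is stable under d: the
    coordinates of exp (t d) v modulo U are polynomials in t. *)
Lemma exp_nil_stable (U : {vspace L}) :
    (forall t, {in U, forall v, exp_nil t v \in U}) ->
  {in U, forall v, d v \in U}.
Proof.
move=> expU v Uv; have [m0|m_gt0] := posnP m.
  by have := dm0 (d v); rewrite m0 /= => ->; apply: mem0v.
have -> : d v = divpow 1 v by rewrite /divpow (_ : 1`! = 1%N) // invr1 scale1r.
suff r0 : divpow 1 v - projv U (divpow 1 v) = 0.
  by move/eqP: r0; rewrite subr_eq0 => /eqP ->; apply: memv_proj.
apply: v2r_inj; apply/rowP => i; rewrite linear0 mxE.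
pose p := \poly_(k < m + m) (v2r (divpow k v - projv U (divpow k v))) 0 i.
suff p0 : p = 0.
  have := coef0 C 1; rewrite -p0 coef_poly -(prednK m_gt0) addSn addnS ltnS => <- //.
have p_t t : p.[t] = 0.
  have Ue := expU t v Uv; have := projv_id Ue => /eqP.
  rewrite eq_sym -subr_eq0 => /eqP/(congr1 v2r)/rowP/(_ i).
  rewrite linear0 mxE => <-; rewrite horner_poly /exp_nil.
  rewrite linear_sum -sumrB linear_sum summxE; apply: eq_bigr => k _.
  move: (divpow k v) => w; rewrite /= [projv U (_ *: _)]linearZ /= -scalerBr.
  by rewrite /= [v2r (_ *: _)]linearZ mxE mulrC.
apply/eqP/negPn/negP => nzp; pose rs : seq C := [seq k%:R | k <- iota 0 (size p)].
have := @max_poly_roots _ p rs nzp; rewrite size_map size_iota ltnn => h.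
suff : false by []; apply: h.
  by apply/allP => t _; rewrite rootE p_t.
rewrite map_inj_uniq ?iota_uniq //; move=> k l /eqP; rewrite eqr_nat.
by move/eqP.
Qed.

End ExpNilpotent.

(** * The Frattini subalgebra is an ideal *)

Section FrattiniIdeal.
Variables (R : realType) (L : lieAlgType R[i]).
Implicit Types (x y z v w : L) (a b : R[i]).
Local Notation F := (frattini {:L}%VS).

(** The automorphism acting as exp (u a) on the generalized eigenspace for a
    preserves the Frattini subalgebra, hence so does its logarithm, which is a
    polynomial in it. *)
Lemma frattini_real_part y (u : R[i] -> R) :
    (forall a b, u (a + b) = u a + u b) ->
  exists2 D : 'End(L), forall a v, geigen (adl y) a v -> D v = (u a)%:C%C *: v &
    {in F, forall v, D v \in F}.
Proof.
move=> uD; pose chi a : R[i] := (expR (u a))%:C%C.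
have chiD a b : chi (a + b) = chi a * chi b by rewrite /chi uD expRD rmorphM.
have nz_chi a : chi a != 0 by rewrite fmorph_eq0 gt_eqF ?expR_gt0.
have [f [fE _ _]] := spectral_calculus (adl y) chi.
have [g [gE _ _]] := spectral_calculus (adl y) (fun a => (chi a)^-1).
have fM := geigen_automorphism (adl_is_derivation y) chiD fE.
have gf v : g (f v) = v.
  move: v; apply: (@geigen_ind _ _ (adl y)) => [|v w gv gw|a v av].
  - by rewrite !linear0.
  - by rewrite !linearD /= gv gw.
  - by rewrite (fE _ _ av) linearZ /= (gE _ _ av) scalerA divff ?scale1r.
have kf : lker f = 0%VS.
  by apply/eqP/lker0P => v w /(congr1 g); rewrite !gf.
have [s sP] := spectrum_ex (adl y).
have [h hP] :=
  poly_interpolation (fun b : R[i] => (ln (complex.Re b))%:C%C) 1 (map chi s).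
exists (pact f h) => [a v av|]; last exact/pact_stable/frattini_automorphism.
have [sa|nsa] := boolP (a \in s); last first.
  by have [_ ->] := geigen_bound sP av (leqnn _); rewrite ?linear0 ?scaler0.
rewrite (pact_eigen _ (fE _ _ av)); congr (_ *: _).
have /dvdpP[q] := hP _ (map_f chi sa).
move/eqP; rewrite subr_eq expr1 => /eqP ->.
by rewrite hornerD hornerM hornerXsubC subrr mulr0 add0r hornerC /= expRK.
Qed.

(** Jordan decomposition of ad y: the Frattini subalgebra is stable under the
    semisimple part s, and under the nilpotent part through its exponential. *)
Theorem frattini_ideal : lie_ideal fullv F.
Proof.
rewrite /lie_ideal subvf /=; apply/lievP => y v _ Fv.
have [D1 D1E D1F] := @frattini_real_part y (@complex.Re R) (fun a b => raddfD _ a b).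
have [D2 D2E D2F] := @frattini_real_part y (@complex.Im R) (fun a b => raddfD _ a b).
have [s [sE sF]] : exists s : 'End(L),
    (forall a w, geigen (adl y) a w -> s w = a *: w) /\ {in F, forall w, s w \in F}.
  exists (D1 + 'i%C *: D2); split=> [a w aw|w Fw]; rewrite add_lfunE scale_lfunE.
    rewrite (D1E _ _ aw) (D2E _ _ aw) scalerA -scalerDl.
    by congr (_ *: _); rewrite [RHS]complexE.
  by rewrite memvD ?memvZ ?D1F ?D2F.
have ders := geigen_derivation (adl_is_derivation y) (fun a b => erefl (a + b)) sE.
pose n := adl y - s.
have dern : derivation n.
  move=> x z; rewrite /n !(add_lfunE, opp_lfunE) (adl_is_derivation y) ders.
  by rewrite lieBl lieBr opprD addrACA.
have [sp spP] := spectrum_ex (adl y).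
have nil_n w : iter (size sp) n w = 0.
  move: w; apply: (@geigen_ind _ _ (adl y)) => [|w1 w2 E1 E2|a w aw].
  - by rewrite -pactXn linear0.
  - by rewrite -pactXn linearD /= !pactXn E1 E2 addr0.
  have [<- _] := geigen_bound spP aw (leqnn _).
  elim: (size sp) => [|k IHk]; first by rewrite expr0 pact1.
  rewrite iterS IHk exprS pactM pactXsubC /n add_lfunE opp_lfunE (sE a) //.
  by have [j aw0] := aw; exists j; rewrite -pactM mulrC pactM aw0 linear0.
have nF : {in F, forall w, n w \in F}.
  apply: (exp_nil_stable nil_n) => t.
  pose e : 'End(L) := linfun (exp_nil n (size sp) t).
  have eE w : e w = exp_nil n (size sp) t w by rewrite lfunE.
  move=> w Fw; rewrite -eE; apply: frattini_automorphism Fw => [x z|].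
    by rewrite !eE (exp_nil_lie dern nil_n).
  apply/eqP; rewrite -subv0; apply/subvP => x; rewrite memv_ker eE memv0 => /eqP.
  by move/(exp_nil_ker nil_n) ->.
have -> : lie y v = n v + s v by rewrite -add_lfunE subrK adlE.
by rewrite memvD ?nF ?sF.
Qed.

End FrattiniIdeal.

(** * Comparison of the indices *)

Theorem proposition9p17 (R : realType) (L : lieAlgType R[i]) :
  (forall nilL : nilpotent {:L}%VS,
     frattini_index {:L}%VS = jacobson_index {:L}%VS /\
     jacobson_index {:L}%VS =
       solvability_index {:L}%VS (nilpotent_solvable (lie_subalgf L) nilL)) /\
  ({:L}%VS != 0%VS ->
     let iN := solvability_index (nilradical L) (nilradical_solvable L) in
     let iK := solvability_index (lie_rad L) (lie_rad_solvable L) in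
     let rF := frattini_index {:L}%VS in
     let rJ := jacobson_index {:L}%VS in
     [/\ (iN <= rF)%N, (rF <= rJ)%N, rJ = (iK + 1)%N & (iK + 1 <= iN + 1)%N] /\
     [/\ (1 <= rF)%N, (rF <= rJ)%N & (rJ <= rF + 1)%N]).
Proof.
split=> [nilL|nzL iN iK rF rJ].
  have sL := lie_subalgf L; pose solL := nilpotent_solvable (lie_subalgf L) nilL.
  have -> : frattini_index {:L}%VS = solvability_index _ solL.
    by apply: stable_index_derived => n; apply: iter_frattini_nilpotent.
  suff -> : jacobson_index {:L}%VS = solvability_index _ solL by [].
  by apply: stable_index_derived => n; apply: iter_jacobson_nilpotent.
have sKJ : (frattini {:L} <= lie_rad L)%VS.
  by rewrite -jacobsonE; apply: frattini_sub_jacobson; apply: frattini_ideal.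
have sF := lie_ideal_subalg (frattini_ideal L).
have nF := nilpotentS sKJ (lie_rad_nilpotent L).
have solF := nilpotent_solvable sF nF.
have rFE : rF = (solvability_index _ solF).+1.
  apply: stable_index_derived_step => [|n]; first exact: frattini_proper.
  by rewrite iterSr; apply: iter_frattini_nilpotent.
have rJE : rJ = iK.+1.
  apply: stable_index_derived_step => [|n].
    apply: contraNneq nzL => eK; rewrite -subv0.
    apply: nilpotent_generated (lie_subalgf L) _ _ (sub0v _) _.
    - by rewrite -eK; apply: lie_rad_nilpotent.
    - by rewrite /lie_subalg liev0.
    - by rewrite add0v -{1}eK; apply: lievS (subvv _) (subvf _).
  rewrite iterSr jacobsonE; apply: iter_jacobson_nilpotent.
    exact: lie_ideal_subalg (lie_rad_ideal L).
  exact: lie_rad_nilpotent.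
have iFK : (solvability_index _ solF <= iK)%N.
  rewrite solvability_index_leq -subv0.
  have /eqP <- : derived iK (lie_rad L) == 0%VS.
    by rewrite -(solvability_index_leq (lie_rad_solvable L)).
  exact: derivedS.
have iKN : (iK <= iN)%N.
  rewrite solvability_index_leq -subv0.
  have /eqP <- : derived iN (nilradical L) == 0%VS.
    by rewrite -(solvability_index_leq (nilradical_solvable L)).
  exact/derivedS/lie_rad_sub_nilradical.
have iNF : (iN <= rF)%N.
  rewrite rFE solvability_index_leq -subv0.
  have /eqP <- : derived (solvability_index _ solF) (frattini {:L}%VS) == 0%VS.
    by rewrite -(solvability_index_leq solF).
  rewrite /derived iterSr; apply: derivedS.
  apply: derived_nilpotent_ideal_sub_frattini; first exact: nilradical_ideal.
  exact: nilradical_nilpotent.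
have rFJ : (rF <= rJ)%N by rewrite rFE rJE ltnS.
split; split; rewrite // ?addn1 ?rJE ?ltnS ?rFE //.
by apply: leq_trans iKN _; rewrite -rFE.
Qed.
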